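(* Let $(G_1,G_2)\sim\mathcal G(n,d,\rho,r)$ with latent bijection $\pi^*$, and suppose there is a universal constant $\Gamma$ such that $$\frac1\Gamma\le\frac{n\log\frac1{1-\rho^2}}{d\log\frac1{1-r^2}}\le\Gamma .$$ For any constant $\delta\in(0,1/2)$ there is a constant $C_0=C_0(\delta,\Gamma)$ such that, if $d=\omega(\log n)$ and $n\log\frac1{1-\rho^2}+d\log\frac1{1-r^2}\ge C_0\log n$, then there exists an estimator $\hat\pi_\lambda$ depending only on $\lambda,G_1,G_2$, namely $$\hat\pi_\lambda\in\arg\max_{\pi\in\mathcal S_n}\left\{\lambda\sum_{e\in E(G_1)}\beta_e(G_1)\beta_{\pi(e)}(G_2)+(1-\lambda)\sum_{v\in V(G_1)}\bm{x}_v^\top\bm{y}_{\pi(v)}\right\},$$ such that for all $\lambda\in(\delta,1-\delta)$, $$\mathbb P\left[\hat\pi_\lambda\ne\pi^*\right]=o(1).$$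
   Context: Featured correlated Gaussian Wigner model $\mathcal G(n,d,\rho,r)$, with $n,d\in\mathbb N$ and $\rho,r\in(0,1)$: $G_1,G_2$ are weighted complete graphs with vertex sets $V(G_1),V(G_2)$ of size $n$; $E(G_i)$ is the set of unordered pairs of distinct vertices; $\beta_e(G_i)\in\mathbb R$ is the weight of edge $e$; each $u\in V(G_1)$ carries a feature $\bm{x}_u\in\mathbb R^d$ and each $v\in V(G_2)$ a feature $\bm{y}_v\in\mathbb R^d$. Given a latent bijection $\pi^*:V(G_1)\to V(G_2)$ (bijections act on edges by $\pi(uv)=\pi(u)\pi(v)$): the pairs $(\beta_e(G_1),\beta_{\pi^*(e)}(G_2))$, $e\in E(G_1)$, are i.i.d. pairs of standard normals with correlation $\rho$; the pairs $(\bm{x}_u,\bm{y}_{\pi^*(u)})$, $u\in V(G_1)$, are i.i.d. $\mathcal N(0,\Sigma_d)$ with $\Sigma_d=\begin{bmatrix} I_d & r I_d \\ r I_d & I_d \end{bmatrix}$; features are independent of edge weights. $\mathcal S_n$ is the set of bijections $V(G_1)\to V(G_2)$. Asymptotics are as $n\to\infty$; $d,\rho,r$ may depend on $n$. *)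

(* Defs.v *)
From HB Require Import structures.
From mathcomp Require Export all_boot all_order all_fingroup all_algebra.
From mathcomp Require Export all_classical all_reals all_analysis.

Set Implicit Arguments.
Unset Strict Implicit.
Unset Printing Implicit Defensive.

Import Order.TTheory GRing.Theory Num.Theory.
Import numFieldNormedType.Exports.

Local Open Scope classical_set_scope.
Local Open Scope ring_scope.

(* Both vertex sets are labelled by 'I_n, so that bijections between them are
   the elements of 'S_n. *)
Definition edge (n : nat) := {e : {set 'I_n} | #|e| == 2}.

Lemma edge_map_subproof n (pi : 'S_n) (e : edge n) :
  #|pi @: (val e)| == 2.
Proof. by rewrite card_imset; [exact: (valP e) | exact: perm_inj]. Qed.

Definition edge_map n (pi : 'S_n) (e : edge n) : edge n :=
  exist _ (pi @: (val e)) (edge_map_subproof pi e).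

Record fgraph (R : realType) (n d : nat) := FGraph {
  weight : edge n -> R;
  feature : 'I_n -> 'rV[R]_d
}.

Definition score (R : realType) (n d : nat) (lambda : R) (G1 G2 : fgraph R n d)
    (pi : 'S_n) : R :=
  lambda * (\sum_(e : edge n) weight G1 e * weight G2 (edge_map pi e))
  + (1 - lambda) *
    (\sum_(v : 'I_n) (feature G1 v *m (feature G2 (pi v))^T) 0 0).

Definition is_argmax (R : realType) (n d : nat) (lambda : R)
    (G1 G2 : fgraph R n d) (pi : 'S_n) : Prop :=
  forall sigma : 'S_n, score lambda G1 G2 sigma <= score lambda G1 G2 pi.

Definition fgraph_coord (R : realType) (n d : nat) (G : fgraph R n d)
    (c : edge n + 'I_n * 'I_d) : R :=
  match c with
  | inl e => weight G e
  | inr (v, k) => feature G v 0 k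
  end.

(* Product Borel sigma-algebra on pairs of featured graphs. *)
Definition observable (R : realType) (n d : nat) :
    set (set (fgraph R n d * fgraph R n d)) :=
  <<s \bigcup_(c in [set: edge n + 'I_n * 'I_d])
        (preimage_set_system setT (fun G => fgraph_coord G.1 c) measurable `|`
         preimage_set_system setT (fun G => fgraph_coord G.2 c) measurable) >>.

(* An estimator sees only lambda and the two observed graphs (whose types
   carry n and d). *)
Definition estimator (R : realType) :=
  forall n d : nat, R -> fgraph R n d -> fgraph R n d -> 'S_n.

Definition measurable_estimator (R : realType) (pihat : estimator R) : Prop :=
  forall (n d : nat) (lambda : R) (pi : 'S_n),
    observable [set G : fgraph R n d * fgraph R n d |
                 pihat n d lambda G.1 G.2 = pi].

Section Probability.
Context (disp : measure_display) (T : measurableType disp) (R : realType).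
Variable P : probability T R.

(* The sigma-algebra generated by a family of random row vectors. *)
Definition sigma_of (I : finType) (m : nat) (X : I -> T -> 'rV[R]_m) :
    set (set T) :=
  <<s \bigcup_(c in [set: I * 'I_m])
        preimage_set_system setT (fun w => X c.1 w 0 c.2) measurable >>.

Definition mutually_independent (I : finType) (F : I -> set (set T)) : Prop :=
  forall (J : {set I}) (A : I -> set T), (forall i, i \in J -> F i (A i)) ->
    P (\bigcap_(i in [set` J]) A i) = (\prod_(i in J) P (A i))%E.

Definition independent_family (I : finType) (m : nat)
    (X : I -> T -> 'rV[R]_m) : Prop :=
  mutually_independent (fun i : I => sigma_of (fun _ : unit => X i)).

Definition independent_sigma (F G : set (set T)) : Prop :=
  forall A B, F A -> G B -> P (A `&` B) = (P A * P B)%E.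

Definition standard_normal_vector (m : nat) (Z : T -> 'rV[R]_m) : Prop :=
  [/\ forall i : 'I_m, measurable_fun setT (fun w => Z w 0 i),
      forall (i : 'I_m) (B : set R), measurable B ->
        P [set w | B (Z w 0 i)] = normal_prob 0 1 B
    & mutually_independent (fun i : 'I_m =>
        preimage_set_system setT (fun w => Z w 0 i) measurable)].

(* X ~ N(0, Sigma): X = Sigma^(1/2) Z with Z a standard normal vector and
   Sigma^(1/2) the symmetric positive semidefinite square root, in row-vector
   convention.  When Sigma is invertible, Z is the random vector
   Sigma^(-1/2) X, so asking for it on the space T only constrains the law
   of X. *)
Definition centered_gaussian (m : nat) (X : T -> 'rV[R]_m) (Sigma : 'M[R]_m) :
    Prop :=
  exists (S : 'M[R]_m) (Z : T -> 'rV[R]_m),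
    [/\ S^T = S,
        forall v : 'rV[R]_m, 0 <= (v *m S *m v^T) 0 0,
        S *m S = Sigma,
        standard_normal_vector Z
      & forall w, X w = Z w *m S].

Definition Sigma_mx (m : nat) (r : R) : 'M[R]_(m + m) :=
  block_mx 1%:M r%:M r%:M 1%:M.

Definition edge_pair (n d : nat) (G1 G2 : T -> fgraph R n d) (pi : 'S_n)
    (e : edge n) (w : T) : 'rV[R]_(1 + 1) :=
  row_mx (weight (G1 w) e)%:M (weight (G2 w) (edge_map pi e))%:M.

Definition feature_pair (n d : nat) (G1 G2 : T -> fgraph R n d) (pi : 'S_n)
    (u : 'I_n) (w : T) : 'rV[R]_(d + d) :=
  row_mx (feature (G1 w) u) (feature (G2 w) (pi u)).

(* (G1, G2) ~ G(n, d, rho, r) with latent bijection pi; a pair of standard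
   normals with correlation rho is a N(0, Sigma_mx 1 rho) vector. *)
Definition featured_gaussian_wigner (n d : nat) (rho r : R) (pi : 'S_n)
    (G1 G2 : T -> fgraph R n d) : Prop :=
  [/\ forall e, centered_gaussian (edge_pair G1 G2 pi e) (Sigma_mx 1 rho),
      independent_family (edge_pair G1 G2 pi),
      forall u, centered_gaussian (feature_pair G1 G2 pi u) (Sigma_mx d r),
      independent_family (feature_pair G1 G2 pi)
    & independent_sigma (sigma_of (edge_pair G1 G2 pi))
                        (sigma_of (feature_pair G1 G2 pi))].

End Probability.

(* Main.v *)
From HB Require Import structures.
Require Import Defs.
From mathcomp Require Import measurable_realfun ring lra.

(** The estimator is any maximiser of the score.  It fails only if some
permutation sigma <> 1 of the labels makes the score of sigma * pistar at
least that of pistar, so the failure probability is at most the sum over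
sigma <> 1 of E exp (t * (score (sigma * pistar) - score pistar)), for any
t >= 0.

Put the edges and the pairs (vertex, feature coordinate) in one index set.  The
coordinates X_c of the first graph and Y_c of the second one, aligned by
pistar, form independent pairs of standard normals with correlation rho or r,
and the score difference is the sum of w_c X_c (Y_(tau c) - Y_c), where tau is
the action of sigma on indices and w_c is lambda or 1 - lambda
[score_diff].  The graph whose edges join c to tau c has maximal degree 2, so
the indices moved by tau can be 3-coloured with c and tau c of different
colours; Hoelder's inequality for three factors reduces the exponential moment
to one colour at a time, where the terms X_c (Y_(tau c) - Y_c) are independent.
A Gaussian computation, integrating out one normal variable at a
time [gauss_peel], bounds the factor of one index by (1 + s r) ^ (-1/2), s being
3 t w_c and r the correlation, as soon as 0 <= s <= r / 2.  This gives
[permuted_correlation_mgf]: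

  E exp (t * difference) <= exp (- (1/6) sum over moved c of ln (1 + s_c r_c)).

The two kinds of correlation may be of very different sizes, but it suffices to
use one of them: t is taken as large as the constraints s <= r / 2 allow for
both kinds, one constraint is then an equality, and the terms of the other kind
are nonnegative.  If sigma moves k vertices, it moves k d feature indices and
at least k (n - 2) / 2 edges, so each kind alone is enough to get the bound
n ^ (-3 k) [exists_exponent].  Since the number of moved points of a map is a
sum over the points, the sum of x ^ k over all permutations is at most the same
sum over all maps, that is (1 + (n - 1) x) ^ n [sum_moved_le]; with x = n ^ (-3)
and without the identity it tends to 0.

The hypothesis that d grows faster than log n enters when r is close to 1:
ln (1 + r ^ 2 / 2) stays bounded while ln (1 / (1 - r ^ 2)) does not. *)

Set Implicit Arguments.
Unset Strict Implicit.
Unset Printing Implicit Defensive.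

Import Order.TTheory GRing.Theory Num.Theory.
Import numFieldNormedType.Exports.

Local Open Scope classical_set_scope.
Local Open Scope ring_scope.

(** * Gaussian integrals *)

(** The standard normal law, on the Borel real line. *)
Definition gauss (R : realType) : probability (measurableTypeR R) R :=
  normal_prob 0 1.

Lemma ge0_integral_gauss (R : realType) (f : R -> \bar R) :
  measurable_fun setT f -> (forall x, 0 <= f x)%E ->
  (\int[gauss R]_x f x =
   \int[lebesgue_measure]_x (f x * (normal_pdf 0 1 x)%:E))%E.
Proof.
move=> mf f0.
have dom : gauss R `<< (@lebesgue_measure R) := @normal_prob_dominates R 0 1.
rewrite -(Radon_Nikodym_SigmaFinite.change_of_variables dom)//.
have mpdf : measurable_fun setT (fun x : R => (normal_pdf 0 1 x)%:E).
  by apply/measurable_EFinP; exact: measurable_normal_pdf.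
have iRN := Radon_Nikodym_SigmaFinite.f_integrable dom.
apply: ae_eq_integral => //.
- by apply: emeasurable_funM => //; exact: measurable_int iRN.
- exact: emeasurable_funM.
- apply: ae_eqe_mul2l; apply: integral_ae_eq => //.
  by move=> E _ mE; rewrite -Radon_Nikodym_SigmaFinite.f_integral.
Qed.

(** Completing the square: the integrand times the standard normal density is a
constant times the density of mean be / (1 + al) and variance 1 / (1 + al). *)
Lemma gauss_mgf (R : realType) (al be ga : R) : 0 < 1 + al ->
  (\int[gauss R]_u (expR (- (al / 2) * u ^+ 2 + u * be + ga))%:E =
   ((Num.sqrt (1 + al))^-1 * expR (be ^+ 2 / (2 * (1 + al)) + ga))%:E)%E.
Proof.
move=> al0.
have mq : measurable_fun setT (fun u : R => expR (- (al / 2) * u ^+ 2 + u * be + ga)).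
  apply: measurableT_comp => //; apply: measurable_funD => //.
  by apply: measurable_funD => //; apply: measurable_funM => //; exact: measurable_funX.
rewrite ge0_integral_gauss//; last exact/measurable_EFinP.
pose s := (Num.sqrt (1 + al))^-1.
have s0 : s != 0 by rewrite invr_eq0 gt_eqF// sqrtr_gt0.
have s2 : s ^+ 2 = (1 + al)^-1 by rewrite exprVn sqr_sqrtr// ltW.
pose K := s * expR (be ^+ 2 / (2 * (1 + al)) + ga).
have K0 : (0 <= K%:E)%E by rewrite lee_fin mulr_ge0 ?expR_ge0// invr_ge0.
pose g x : \bar R := (normal_pdf (be / (1 + al)) s x)%:E.
have mg : measurable_fun setT g.
  by apply/measurable_EFinP; exact: measurable_normal_pdf.
have g0 x : (0 <= g x)%E by rewrite lee_fin normal_pdf_ge0.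
transitivity (K%:E * \int[lebesgue_measure]_x g x)%E; last first.
  by rewrite /g integral_normal_pdf mule1.
rewrite -(ge0_integralZl lebesgue_measure measurableT mg (fun x _ => g0 x) K0).
apply: eq_integral => x _; rewrite -!EFinM !normal_pdfE ?oner_eq0//=.
congr (_%:E); rewrite /normal_peak /normal_fun s2 subr0 expr1n.
rewrite -mulrnAr mul1r -mulrnAr sqrtrM ?invr_ge0 ?(ltW al0)//.
rewrite sqrtrV ?(ltW al0)// invfM invrK -/s.
set p := (Num.sqrt (pi *+ 2))^-1.
transitivity (p * expR (- (al / 2) * x ^+ 2 + x * be + ga + - x ^+ 2 / (1 *+ 2))).
  by rewrite (expRD (_ + ga)); ring.
transitivity (p * expR (be ^+ 2 / (2 * (1 + al)) + ga +
    - (x - be / (1 + al)) ^+ 2 / ((1 + al)^-1 *+ 2))).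
  by congr (_ * expR _); field; rewrite gt_eqF.
have sq : s * Num.sqrt (1 + al) = 1 by rewrite mulVf// -invr_eq0.
by rewrite (expRD (_ + ga)) /K; ring: sq.
Qed.

(** * Integrating out one of several independent normal variables *)

(** If U has law mu and is independent of V, integrating f (U, V) amounts to
integrating over the values of U first, with V fixed. *)
Lemma ge0_integral_independent d d' (T : measurableType d)
    (T' : measurableType d') (R : realType) (P : probability T R)
    (mu : probability (measurableTypeR R) R) (U : T -> R) (V : T -> T')
    (f : measurableTypeR R * T' -> \bar R) :
  measurable_fun setT U -> measurable_fun setT V ->
  (forall A B, measurable A -> measurable B ->
    P (U @^-1` A `&` V @^-1` B) = mu A * P (V @^-1` B))%E ->
  measurable_fun setT f -> (forall z, 0 <= f z)%E ->
  (\int[P]_w f (U w, V w) = \int[P]_w \int[mu]_u f (u, V w))%E.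
Proof.
move=> mU mV indep mf f0.
pose W w : measurableTypeR R * T' := (U w, V w).
have mW : measurable_fun setT W by exact: measurable_fun_pair.
pose Vm : {mfun T >-> T'} := HB.pack V (isMeasurableFun.Build _ _ _ _ _ mV).
pose Wm : {mfun T >-> (measurableTypeR R * T')%type} :=
  HB.pack W (isMeasurableFun.Build _ _ _ _ _ mW).
pose PV : probability T' R := distribution P Vm.
pose PW : probability (measurableTypeR R * T')%type R := distribution P Wm.
rewrite -[LHS]/(\int[P]_w (f \o Wm) w)%E -ge0_integral_distribution//.
rewrite -[RHS]/(\int[P]_w ((fun v => \int[mu]_u f (u, v)) \o Vm) w)%E.
rewrite -ge0_integral_distribution//; first last.
- by move=> y; exact: integral_ge0.
- exact: measurable_fun_fubini_tonelli_G.
rewrite -(fubini_tonelli2 (m1 := mu) (m2 := PV)) //.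
apply: eq_measure_integral => A mA _.
by apply/esym/product_measure_unique => // B C mB mC; exact: indep.
Qed.

Section gaussian_family.
Context d (T : measurableType d) (R : realType) (P : probability T R).
Variables (J : finType) (Z : J -> T -> R).

(** The Z j are independent standard normals, stated as: their joint law gives
every box the product measure. *)
Definition iid_gauss : Prop :=
  (forall j, measurable_fun setT (Z j)) /\
  forall B : J -> set R, (forall j, measurable (B j)) ->
    P [set w | forall j, B j (Z j w)] = (\prod_j gauss R (B j))%E.

(** The boxes that do not constrain the coordinate j0: a pi-system generating
the sigma-algebra of the Z j with j != j0. *)
Definition boxes_avoiding (j0 : J) : set (set T) :=
  [set A | exists2 B : J -> set R, forall j, measurable (B j) &
           A = [set w | forall j, j != j0 -> B j (Z j w)]].

Hypothesis iidZ : iid_gauss.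

Lemma boxes_avoidingT j0 : boxes_avoiding j0 setT.
Proof. by exists (fun=> setT) => //; apply/seteqP; split. Qed.

Lemma boxes_avoidingI j0 : setI_closed (boxes_avoiding j0).
Proof.
move=> _ _ [B mB ->] [C mC ->]; exists (fun j => B j `&` C j).
  by move=> j; exact: measurableI.
by apply/seteqP; split=> [w [Bw Cw] j jj0|w BCw]; [split; [exact: Bw|exact: Cw]|
  split=> j /BCw[]].
Qed.

Lemma boxes_avoiding_measurable j0 : boxes_avoiding j0 `<=` measurable.
Proof.
move=> _ [B mB ->].
rewrite (_ : mkset _ = \bigcap_(j in [set` [pred j | j != j0]]) (Z j @^-1` B j)); last first.
  by apply/seteqP; split.
apply: fin_bigcap_measurable => [|j _]; first exact: finite_finset.
by rewrite -[X in measurable X]setTI; exact: iidZ.1.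
Qed.

Lemma box_avoidingE j0 (A : set R) (B : J -> set R) : measurable A ->
  (forall j, measurable (B j)) ->
  P (Z j0 @^-1` A `&` [set w | forall j, j != j0 -> B j (Z j w)]) =
  (gauss R A * \prod_(j | j != j0) gauss R (B j))%E.
Proof.
move=> mA mB; pose B' j := if j == j0 then A else B j.
have mB' j : measurable (B' j) by rewrite /B'; case: ifP.
have := iidZ.2 _ mB'; rewrite (bigD1 j0)//=.
have -> : B' j0 = A by rewrite /B' eqxx.
under eq_bigr => j /negbTE jj0 do rewrite /B' jj0.
move=> <-; congr (P _); apply/seteqP; split=> w /=.
  by move=> [Aw Bw] j; rewrite /B'; case: eqVneq => [->//|/Bw].
move=> Bw; split; first by have := Bw j0; rewrite /B' eqxx.
by move=> j jj0; have := Bw j; rewrite /B' (negbTE jj0).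
Qed.

(** Z j0 is independent of the sigma-algebra generated by the other
coordinates: two finite measures that agree on a pi-system are equal. *)
Lemma independent_boxes_avoiding j0 (A : set R) (E : set T) : measurable A ->
  <<s boxes_avoiding j0 >> E ->
  P (Z j0 @^-1` A `&` E) = (gauss R A * P E)%E.
Proof.
move=> mA sE.
have mZA : measurable (Z j0 @^-1` A).
  by rewrite -[X in measurable X]setTI; exact: iidZ.1.
have gA : gauss R A \is a fin_num by exact: fin_num_measure.
have c0 : 0 <= fine (gauss R A) by exact: fine_ge0.
rewrite setIC -[RHS]/(_ * _)%E -(fineK gA).
apply: (g_sigma_algebra_measure_unique (boxes_avoiding j0)
  (boxes_avoiding_measurable (j0:=j0)) (fun=> setT) _ _
  (mrestr P mZA) (mscale (NngNum c0) P)) => //.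
- by move=> _; exact: boxes_avoidingT.
- exact: bigcup_const.
- exact: boxes_avoidingI.
- move=> _ [B mB ->]; rewrite /= /mrestr /mscale/= setIC box_avoidingE// fineK//.
  have := box_avoidingE j0 measurableT mB; rewrite preimage_setT setTI => ->.
  by rewrite probability_setT mul1e.
- by move=> _; rewrite /= /mrestr setTI (le_lt_trans (probability_le1 _ _)) ?ltry.
Qed.

End gaussian_family.

Section peeling.
Context d (T : measurableType d) (R : realType) (P : probability T R).
Variables (J : finType) (Z : J -> T -> R).
Hypothesis iidZ : iid_gauss P Z.

(** Random variables that are functions of the Z j, j != j0: measurable for the
sigma-algebra that these generate. *)
Definition avoids (j0 : J) (f : T -> R) : Prop :=
  measurable_fun [set: g_sigma_algebraType (boxes_avoiding Z j0)] f.

Lemma avoids_measurable j0 (f : T -> R) : avoids j0 f -> measurable_fun setT f.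
Proof.
move=> mf _ B mB; apply: (smallest_sub (@sigma_algebra_measurable _ T)).
  exact: boxes_avoiding_measurable iidZ j0.
exact: mf.
Qed.

Lemma avoids_coord j0 j : j != j0 -> avoids j0 (Z j).
Proof.
move=> jj0 _ B mB; apply: sub_sigma_algebra.
exists (fun i => if i == j then B else setT).
  by move=> i; case: ifP.
rewrite setTI; apply/seteqP; split=> w /=.
  by move=> Bw i _; case: eqP => [->|].
by move=> /(_ j jj0); rewrite eqxx.
Qed.

Lemma avoids_cst j0 (c : R) : avoids j0 (fun=> c).
Proof. exact: measurable_cst. Qed.

Lemma avoidsD j0 (f g : T -> R) : avoids j0 f -> avoids j0 g ->
  avoids j0 (fun w => f w + g w).
Proof. exact: measurable_funD. Qed.

Lemma avoidsM j0 (f g : T -> R) : avoids j0 f -> avoids j0 g ->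
  avoids j0 (fun w => f w * g w).
Proof. exact: measurable_funM. Qed.

Lemma avoidsN j0 (f : T -> R) : avoids j0 f -> avoids j0 (fun w => - f w).
Proof. by move=> mf; exact: (measurableT_comp _ mf). Qed.

Lemma avoids_sum (I : Type) (r : seq I) (p : pred I) j0 (f : I -> T -> R) :
  (forall i, p i -> avoids j0 (f i)) ->
  avoids j0 (fun w => \sum_(i <- r | p i) f i w).
Proof.
move=> mf; rewrite (_ : (fun w => _) =
    fun w => \sum_(i <- r) (if p i then f i w else 0)); last first.
  by apply/funext => w; rewrite big_mkcond.
apply: measurable_sum => i; case: (boolP (p i)) => [/mf//|_]; exact: avoids_cst.
Qed.

(** Integrating out Z j0 in the exponential of a polynomial of degree 2 in
Z j0 whose other coefficients do not involve Z j0. *)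
Lemma gauss_peel j0 (al : R) (B C : T -> R) : 0 < 1 + al ->
  avoids j0 B -> avoids j0 C ->
  (\int[P]_w (expR (- (al / 2) * Z j0 w ^+ 2 + Z j0 w * B w + C w))%:E =
   ((Num.sqrt (1 + al))^-1)%:E *
   \int[P]_w (expR (B w ^+ 2 / (2 * (1 + al)) + C w))%:E)%E.
Proof.
move=> al0 mB mC.
have [mB' mC'] := (avoids_measurable mB, avoids_measurable mC).
pose T' : measurableType _ := g_sigma_algebraType (boxes_avoiding Z j0).
pose f (z : measurableTypeR R * T') : \bar R :=
  (expR (- (al / 2) * z.1 ^+ 2 + z.1 * B z.2 + C z.2))%:E.
have mf : measurable_fun setT f.
  apply/measurable_EFinP; apply: measurableT_comp => //.
  have mB2 : measurable_fun setT (fun z : measurableTypeR R * T' => B z.2).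
    exact: (measurableT_comp mB).
  have mC2 : measurable_fun setT (fun z : measurableTypeR R * T' => C z.2).
    exact: (measurableT_comp mC).
  have m1 : measurable_fun setT (fun z : measurableTypeR R * T' => z.1 : R).
    exact: measurable_fst.
  apply: measurable_funD => //; apply: measurable_funD; apply: measurable_funM => //.
  exact: measurable_funX.
have mV : measurable_fun [set: T] (fun w : T => w : T').
  move=> _ E sE; rewrite setTI; move: E sE.
  exact: smallest_sub (@sigma_algebra_measurable _ T) (boxes_avoiding_measurable iidZ (j0 := j0)).
rewrite -[LHS]/(\int[P]_w f (Z j0 w, (fun w : T => w : T') w))%E.
rewrite (ge0_integral_independent (mu := gauss R) (iidZ.1 j0) mV)//; last first.
- by move=> z; rewrite lee_fin expR_ge0.
- by move=> A E mA mE; exact: independent_boxes_avoiding.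
rewrite -(@ge0_integralZl _ _ R P setT measurableT
  (fun w => (expR (B w ^+ 2 / (2 * (1 + al)) + C w))%:E)).
- by apply: eq_integral => w _; rewrite -EFinM -gauss_mgf.
- apply/measurable_EFinP; apply: measurableT_comp => //.
  by apply: measurable_funD => //; apply: measurable_funM => //; exact: measurable_funX.
- by move=> w _; rewrite lee_fin expR_ge0.
- by rewrite lee_fin invr_ge0.
Qed.

(** The case without quadratic term. *)
Lemma gauss_peel_linear j0 (B C : T -> R) : avoids j0 B -> avoids j0 C ->
  (\int[P]_w (expR (Z j0 w * B w + C w))%:E =
   \int[P]_w (expR (B w ^+ 2 / 2 + C w))%:E)%E.
Proof.
move=> mB mC; have al0 : (0 : R) < 1 + 0 by rewrite addr0.
have := gauss_peel al0 mB mC; rewrite addr0 sqrtr1 invr1 mul1e mulr1 => <-.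
by apply: eq_integral => w _; rewrite mul0r oppr0 mul0r add0r.
Qed.

End peeling.

(** * The exponential moment of one product, and of disjoint ones *)

Section blocks.
Context d (T : measurableType d) (R : realType) (P : probability T R).
Variables (I : finType) (Z : I * bool -> T -> R).
Hypothesis iidZ : iid_gauss P Z.
Variables (a b : I -> R).
Hypothesis ab1 : forall i, a i ^+ 2 + b i ^+ 2 = 1.

(** The pair (X_i, Y_i) made from the two normals Z (i, false) and Z (i, true)
by the symmetric matrix with diagonal entries a i and other entries b i.  As
a i ^+ 2 + b i ^+ 2 = 1, both are standard normals, with correlation
r i = 2 * a i * b i. *)
Definition pairX (i : I) (w : T) : R := a i * Z (i, false) w + b i * Z (i, true) w.
Definition pairY (i : I) (w : T) : R := b i * Z (i, false) w + a i * Z (i, true) w.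

Let r i : R := 2 * a i * b i.

Lemma sqrtr_expR_ln (x : R) : 0 < x -> Num.sqrt x = expR (ln x / 2).
Proof.
move=> x0; apply/eqP; rewrite -(@eqrXn2 _ 2) ?expR_ge0// sqr_sqrtr ?ltW//.
by rewrite -expRM_natl mulrC divfK// lnK.
Qed.

Lemma pair_corr_le1 i : r i <= 1.
Proof. by have := ab1 i; have := sqr_ge0 (a i - b i); rewrite /r; nra. Qed.

(* Proves that an explicit polynomial in coordinates does not involve Z j0,
   following its syntax. *)
Ltac avoid :=
  lazymatch goal with
  | |- avoids _ _ (fun w => @?f w + @?g w) => refine (@avoidsD _ _ _ _ _ _ f g _ _); avoid
  | |- avoids _ _ (fun w => @?f w * @?g w) => refine (@avoidsM _ _ _ _ _ _ f g _ _); avoid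
  | |- avoids _ _ (fun w => - (@?f w)) => refine (@avoidsN _ _ _ _ _ _ f _); avoid
  | |- avoids _ _ (fun w => Z ?j w) => refine (avoids_coord _);
      first [by rewrite xpair_eqE andbF | apply/eqP; congruence]
  | |- _ =>
      solve [match goal with H : _ |- _ => first [refine H | refine (H _)] end]
      || refine (@avoids_cst _ _ _ _ _ _ _)
  end.

(** The four normals behind (X_e, Y_e) and Y_e' are integrated out in turn.  The
two of e' enter linearly and leave exp (s ^ 2 X_e ^ 2 / 2 - s X_e Y_e), a
Gaussian integral in two variables of determinant
1 + 2 s r - s ^ 2 (2 - r ^ 2), which is at least 1 + s r when s <= r / 2. *)
Lemma block_mgf (e e' : I) (s : R) (C : T -> R) :
  e != e' -> 0 <= s <= r e / 2 ->
  (forall c, avoids Z (e, c) C) -> (forall c, avoids Z (e', c) C) ->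
  (\int[P]_w (expR (s * pairX e w * (pairY e' w - pairY e w) + C w))%:E <=
   (expR (- (ln (1 + s * r e) / 2)))%:E * \int[P]_w (expR (C w))%:E)%E.
Proof.
move=> /eqP ee' /andP[s0 sr] Ce Ce'.
have ab1e := ab1 e; have ab1e' := ab1 e'; have r1 := pair_corr_le1 e.
(* The exponent left after the two normals of e' are gone is, up to a factor
   - 1 / 2, the quadratic form with matrix [[A, B], [B, D]]; D' is the Schur
   complement that remains of it once Z1 is integrated out. *)
pose A := s * r e - s ^+ 2 * a e ^+ 2.
pose B := s ^+ 2 * a e * b e - s.
pose D := s * r e - s ^+ 2 * b e ^+ 2.
have a2 := sqr_ge0 (a e); have b2 := sqr_ge0 (b e).
have A0 : 0 < 1 + A.
  rewrite /A; have : 0 <= s * (r e - s * a e ^+ 2); last by lra.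
  by apply: mulr_ge0 => //; nra.
pose D' := D - B ^+ 2 / (1 + A).
have b2E : b e ^+ 2 = 1 - a e ^+ 2 by rewrite -ab1e; ring.
have detE : (1 + A) * (1 + D') = 1 + 2 * s * r e - s ^+ 2 * (2 - r e ^+ 2).
  have -> : (1 + A) * (1 + D') = (1 + A) * (1 + D) - B ^+ 2.
    by rewrite /D'; field; rewrite gt_eqF.
  by rewrite /D /B /A /r; ring: b2E.
have det1 : 1 + s * r e <= (1 + A) * (1 + D').
  rewrite detE; have : 0 <= s * (r e - 2 * s) by apply: mulr_ge0 => //; lra.
  by have := sqr_ge0 (s * r e); nra.
have sr0 : 0 <= s * r e by apply: mulr_ge0 => //; lra.
have D'0 : 0 < 1 + D'.
  by rewrite -(pmulr_rgt0 _ A0); lra.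
pose X := pairX e; pose Y := pairY e.
pose Z1 := Z (e, false); pose Z2 := Z (e, true).
pose C1 w := s * a e' * Z (e', true) w * X w + (- s * X w * Y w + C w).
have mX c : avoids Z (e', c) X by rewrite /X /pairX; avoid.
have mY c : avoids Z (e', c) Y by rewrite /Y /pairY; avoid.
rewrite (eq_integral (fun w =>
  (expR (Z (e', false) w * (s * b e' * X w) + C1 w))%:E)); last first.
  by move=> w _; congr (expR _)%:E; rewrite /C1 /X /Y [pairY e' w]/pairY; ring.
rewrite (gauss_peel_linear iidZ (j0 := (e', false))
  (B := fun w => s * b e' * X w) (C := C1)); last 2 first.
  by avoid.
  by rewrite /C1; avoid.
pose C2 w := (s * b e') ^+ 2 / 2 * (X w * X w) + (- s * X w * Y w + C w).
rewrite (eq_integral (fun w =>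
  (expR (Z (e', true) w * (s * a e' * X w) + C2 w))%:E)); last first.
  by move=> w _; congr (expR _)%:E; rewrite /C1 /C2; field.
rewrite (gauss_peel_linear iidZ (j0 := (e', true))
  (B := fun w => s * a e' * X w) (C := C2)); [|avoid|rewrite /C2; avoid].
pose C3 w := - (D / 2) * (Z2 w * Z2 w) + C w.
rewrite (eq_integral (fun w =>
  (expR (- (A / 2) * Z1 w ^+ 2 + Z1 w * (B * Z2 w) + C3 w))%:E)); last first.
  move=> w _; congr (expR _)%:E.
  transitivity (s ^+ 2 / 2 * (a e' ^+ 2 + b e' ^+ 2) * X w ^+ 2 - s * X w * Y w + C w).
    by rewrite /C2; field.
  rewrite ab1e' /C3 /A /B /D /r /X /Y /pairX /pairY -/Z1 -/Z2.
  by field: b2E.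
rewrite (gauss_peel iidZ (j0 := (e, false)) (al := A)
  (B := fun w => B * Z2 w) (C := C3))//; [|rewrite /Z2; avoid|rewrite /C3 /Z2; avoid].
rewrite (eq_integral (fun w =>
  (expR (- (D' / 2) * Z2 w ^+ 2 + Z2 w * 0 + C w))%:E)); last first.
  by move=> w _; congr (expR _)%:E; rewrite /C3 /D'; field; rewrite gt_eqF.
rewrite (gauss_peel iidZ (j0 := (e, true)) (al := D')
  (B := fun=> 0) (C := C))//; last by avoid.
under eq_integral do rewrite expr0n mul0r add0r.
rewrite muleA -EFinM; apply: lee_wpmul2r.
  by apply: integral_ge0 => w _; rewrite lee_fin expR_ge0.
rewrite lee_fin -invfM -sqrtrM ?(ltW A0)// expRN.
have p1 : 0 < 1 + s * r e by rewrite ltr_wpDr.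
rewrite -sqrtr_expR_ln// lef_pV2 ?posrE ?sqrtr_gt0 ?mulr_gt0//.
exact: ler_wsqrtr.
Qed.

Lemma avoids_pair (i : I) c (j : I) : i != j ->
  avoids Z (j, c) (pairX i) /\ avoids Z (j, c) (pairY i).
Proof. by move=> /eqP ij; split; rewrite /pairX /pairY; avoid. Qed.

(** As no index of l has its image in l and tau is injective, the terms of the
sum involve disjoint sets of normals, and are integrated one after the other. *)
Lemma seq_blocks_mgf (tau : I -> I) (s : I -> R) (l : seq I) :
  injective tau -> uniq l -> {in l &, forall i j, tau i != j} ->
  (forall i, i \in l -> 0 <= s i <= r i / 2) ->
  (\int[P]_w (expR (\sum_(i <- l) s i * pairX i w * (pairY (tau i) w - pairY i w)))%:E <=
   (expR (- (\sum_(i <- l) ln (1 + s i * r i) / 2)))%:E)%E.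
Proof.
move=> tau_inj; elim: l => [_ _ _|e l IH /= /andP[el ul] tl sl].
  under eq_integral do rewrite big_nil expR0.
  rewrite big_nil oppr0 expR0 integral_cst// mul1e; exact: probability_le1.
under eq_integral do rewrite big_cons.
have ee : e \in e :: l by rewrite mem_head.
have el' i : i \in l -> i \in e :: l by rewrite inE orbC => ->.
have tle i : i \in l -> [/\ i != e, i != tau e, tau i != e & tau i != tau e].
  move=> il; have ie : i != e by apply: contraNneq el => <-.
  split=> //; last by rewrite (inj_eq tau_inj).
    by rewrite eq_sym; exact: tl ee (el' _ il).
  exact: tl (el' _ il) ee.
have avoidS j c : (forall i, i \in l -> i != j /\ tau i != j) ->
    avoids Z (j, c) (fun w => \sum_(i <- l) s i * pairX i w * (pairY (tau i) w - pairY i w)).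
  move=> lj; rewrite (_ : (fun w => _) = fun w => \sum_(i <- l | i \in l)
      s i * pairX i w * (pairY (tau i) w - pairY i w)); last first.
    by apply/funext => w; rewrite big_seq.
  apply: avoids_sum => i /lj[ij tij].
  have [[mX mY] [_ mtY]] := (avoids_pair c ij, avoids_pair c tij).
  by avoid.
apply: (le_trans (block_mgf _ (sl _ ee) _ _)).
- by rewrite eq_sym tl.
- by move=> c; apply: avoidS => i /tle[].
- by move=> c; apply: avoidS => i /tle[].
rewrite big_cons opprD expRD EFinM.
apply: lee_wpmul2l; first by rewrite lee_fin expR_ge0.
apply: IH => // i; last by move=> il; exact/sl/el'.
by move=> j il jl; apply: tl; exact: el'.
Qed.

End blocks.

(** * Permuted correlations *)

Lemma third_color (x y : 'I_3) : exists k, k != x /\ k != y.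
Proof.
by case: x y => [[|[|[|//]]] ?] [[|[|[|//]]] ?];
  first [by exists 0 | by exists 1 | by exists 2%:R].
Qed.

(** Every index has at most two neighbours, its image and its preimage, so a
greedy choice among three colours succeeds. *)
Lemma three_coloring (I : finType) (tau : I -> I) : injective tau ->
  exists c : I -> 'I_3, forall i, tau i != i -> c (tau i) != c i.
Proof.
move=> tau_inj.
suff [c cP] : exists c : I -> 'I_3, {in enum I, forall i, tau i \in enum I ->
    tau i != i -> c (tau i) != c i}.
  by exists c => i; apply: cP; rewrite mem_enum.
elim: (enum I) => [|e l [c cP]]; first by exists (fun=> 0).
have [k [kx ky]] := third_color (c (tau e)) (c (invF tau_inj e)).
exists (fun i => if i == e then k else c i) => i il til tii.
case: (eqVneq i e) => [ie|ie]; case: (eqVneq (tau i) e) => [tie|tie].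
- by rewrite tie ie eqxx in tii.
- by rewrite eq_sym ie.
- by rewrite -(invF_f tau_inj i) tie.
- by apply: cP => //; [move: il|move: til]; rewrite inE (negbTE ie, negbTE tie).
Qed.

Section hoelder.
Context d (T : measurableType d) (R : realType) (P : probability T R).

(** The convexity inequality behind Hoelder's inequality with three equal
exponents, normalised by reals L c. *)
Lemma expR_sum3_le (x L : 'I_3 -> R) :
  expR (\sum_c x c) <=
  \sum_c (expR ((\sum_c L c) / 3) / 3 * expR (- L c)) * expR (3 * x c).
Proof.
(* The deviations 3 x c - L c - m from the mean m sum to 0, so only the bound
   1 + u <= exp u is needed. *)
pose m := \sum_c x c - (\sum_c L c) / 3.
have -> : expR (\sum_c x c) = expR ((\sum_c L c) / 3) * expR m.
  by rewrite -expRD /m subrKC.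
under [leRHS]eq_bigr do rewrite -!mulrA -expRD.
rewrite -mulr_sumr ler_pM2l ?expR_gt0// -mulr_sumr.
have le1 c : expR m * (1 + (3 * x c - L c - m)) <= expR (- L c + 3 * x c).
  have -> : - L c + 3 * x c = m + (3 * x c - L c - m) by ring.
  by rewrite (expRD m) ler_pM2l ?expR_gt0// expR_ge1Dx.
have := ler_sum _ (fun c (_ : xpredT c) => le1 c) => /(_ (index_enum _)).
rewrite -mulr_sumr (_ : \sum_c (1 + (3 * x c - L c - m)) = 3); last first.
  by rewrite /m !big_ord_recl !big_ord0; field.
by move=> h; rewrite -[leLHS](mulfK (x := 3)) // mulrC ler_wpM2l.
Qed.

(** Hoelder: if E exp (3 x_c) <= exp (L_c) for each of three variables, then
E exp (x_0 + x_1 + x_2) <= exp ((L_0 + L_1 + L_2) / 3). *)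
Lemma integral_expR_sum3_le (x : 'I_3 -> T -> R) (L : 'I_3 -> R) :
  (forall c, measurable_fun setT (x c)) ->
  (forall c, (\int[P]_w (expR (3 * x c w))%:E <= (expR (L c))%:E)%E) ->
  (\int[P]_w (expR (\sum_c x c w))%:E <= (expR ((\sum_c L c) / 3))%:E)%E.
Proof.
move=> mx xL; pose K c := expR ((\sum_c L c) / 3) / 3 * expR (- L c).
have K0 c : 0 <= K c by rewrite mulr_ge0 ?expR_ge0// divr_ge0 ?expR_ge0.
have mE c : measurable_fun setT (fun w => (expR (3 * x c w))%:E).
  apply/measurable_EFinP; apply: measurableT_comp => //.
  exact: measurable_funM.
apply: (@le_trans _ _ (\int[P]_w \sum_c ((K c)%:E * (expR (3 * x c w))%:E))%E).
  apply: ge0_le_integral => //.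
  - apply/measurable_EFinP; apply: measurableT_comp => //.
    exact: (measurable_sum _ mx).
  - apply: emeasurable_sum => c; exact: emeasurable_funM.
  - move=> w _; under [X in (_ <= X)%E]eq_bigr do rewrite -EFinM.
    by rewrite sumEFin lee_fin expR_sum3_le.
rewrite ge0_integral_sum//; first last.
- by move=> c w _; rewrite mule_ge0// lee_fin ?expR_ge0.
- by move=> c; exact: emeasurable_funM.
apply: (@le_trans _ _ (\sum_(c < 3) (K c * expR (L c))%:E)%E).
  apply: lee_sum => c _; rewrite ge0_integralZl ?lee_fin//.
  by rewrite (EFinM (K c)) lee_wpmul2l ?lee_fin.
rewrite sumEFin lee_fin (eq_bigr (fun=> expR ((\sum_c L c) / 3) / 3)); last first.
  by move=> c _; rewrite /K -mulrA -expRD addNr expR0 mulr1.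
by rewrite sumr_const card_ord -[(_ / _) *+ 3]mulr_natr divfK.
Qed.

End hoelder.

Section permuted_correlation.
Context d (T : measurableType d) (R : realType) (P : probability T R).
Variables (I : finType) (Z : I * bool -> T -> R).
Hypothesis iidZ : iid_gauss P Z.
Variables (a b : I -> R).
Hypothesis ab1 : forall i, a i ^+ 2 + b i ^+ 2 = 1.
Let X := pairX Z a b.
Let Y := pairY Z a b.

Lemma measurable_pairX i : measurable_fun setT (X i).
Proof. by apply: measurable_funD; apply: measurable_funM => //; exact: iidZ.1. Qed.

Lemma measurable_pairY i : measurable_fun setT (Y i).
Proof. by apply: measurable_funD; apply: measurable_funM => //; exact: iidZ.1. Qed.

(** Fixed points of tau contribute nothing; the moved ones are split into the
three classes of a colouring. *)
Lemma permuted_correlation_mgf (tau : I -> I) (s : I -> R) : injective tau ->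
  (forall i, 0 <= s i <= 2 * a i * b i / 2) ->
  (\int[P]_w (expR (\sum_i s i / 3 * X i w * (Y (tau i) w - Y i w)))%:E <=
   (expR (- (\sum_(i | tau i != i) ln (1 + s i * (2 * a i * b i))) / 6))%:E)%E.
Proof.
move=> tau_inj sP; have [c cP] := three_coloring tau_inj.
pose x k w := \sum_(i | (tau i != i) && (c i == k)) s i / 3 * X i w * (Y (tau i) w - Y i w).
pose L k := - (\sum_(i | (tau i != i) && (c i == k)) ln (1 + s i * (2 * a i * b i)) / 2).
rewrite (eq_integral (fun w => (expR (\sum_k x k w))%:E)); last first.
  move=> w _; congr (expR _)%:E; rewrite -(partition_big c xpredT)//=.
  rewrite [LHS](bigID (fun i => tau i != i))/= [X in _ + X]big1 ?addr0// => i.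
  by rewrite negbK => /eqP ->; rewrite subrr mulr0.
rewrite (_ : _ / 6 = (\sum_k L k) / 3); last first.
  rewrite /L sumrN -(partition_big c xpredT)//= -mulr_suml.
  by field.
apply: integral_expR_sum3_le.
  move=> k.
  rewrite (_ : x k = fun w => \sum_(i <- enum [pred i | (tau i != i) && (c i == k)])
     s i / 3 * X i w * (Y (tau i) w - Y i w)); last first.
    by apply/funext => w; rewrite big_enum.
  apply: measurable_sum => i; apply: measurable_funM.
    by apply: measurable_funM => //; exact: measurable_pairX.
  by apply: measurable_funB; exact: measurable_pairY.
move=> k.
have := @seq_blocks_mgf _ _ _ P _ _ iidZ _ _ ab1 tau s
  (enum [pred i | (tau i != i) && (c i == k)]) tau_inj (enum_uniq _).
rewrite big_enum => H.
rewrite (eq_integral (fun w => (expR (\sum_(i <- enum [pred i | (tau i != i) && (c i == k)])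
     s i * X i w * (Y (tau i) w - Y i w)))%:E)); last first.
  move=> w _; congr (expR _)%:E; rewrite big_enum/= /x mulr_sumr; apply: eq_bigr => i _.
  by field.
apply: H.
- move=> i j; rewrite !mem_enum !inE => /andP[ti /eqP ci] /andP[_ /eqP cj].
  by apply/eqP => tij; have := cP _ ti; rewrite tij cj ci eqxx.
- by move=> i _; exact: sP.
Qed.
End permuted_correlation.

(** * The square root of the covariance matrix *)

Section square_root.
Variable R : realType.

(** The entries of the positive square root of the matrix with diagonal 1 and
other entries r. *)
Definition rootA (r : R) : R := (Num.sqrt (1 + r) + Num.sqrt (1 - r)) / 2.
Definition rootB (r : R) : R := (Num.sqrt (1 + r) - Num.sqrt (1 - r)) / 2.

Variable r : R.
Hypothesis r01 : 0 < r < 1.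
Let a := rootA r.
Let b := rootB r.

Let sqp : Num.sqrt (1 + r) ^+ 2 = 1 + r.
Proof. by case/andP: r01 => r0 r1; rewrite sqr_sqrtr//; lra. Qed.
Let sqm : Num.sqrt (1 - r) ^+ 2 = 1 - r.
Proof. by case/andP: r01 => r0 r1; rewrite sqr_sqrtr//; lra. Qed.

Lemma root_norm : a ^+ 2 + b ^+ 2 = 1.
Proof. by rewrite /a /b /rootA /rootB; field: sqp sqm. Qed.

Lemma root_corr : 2 * a * b = r.
Proof. by rewrite /a /b /rootA /rootB; field: sqp sqm. Qed.

Lemma rootB_gt0 : 0 < b.
Proof.
case/andP: r01 => r0 r1; rewrite /b /rootB divr_gt0// subr_gt0 ltr_sqrt; lra.
Qed.

Lemma rootAB_gt0 : 0 < a - b.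
Proof.
case/andP: r01 => r0 r1; rewrite /a /b /rootA /rootB.
have : 0 < Num.sqrt (1 - r) by rewrite sqrtr_gt0; lra.
lra.
Qed.

Variable m : nat.

Definition root_mx : 'M[R]_(m + m) := block_mx a%:M b%:M b%:M a%:M.

(** root_mx is positive definite, in the form used for uniqueness: the quadratic
form is b |x + y| ^ 2 + (a - b) (|x| ^ 2 + |y| ^ 2) at the vector (x, y). *)
Lemma root_mx_posdef (v : 'rV[R]_(m + m)) :
  (v *m root_mx *m v^T) 0 0 <= 0 -> v = 0.
Proof.
rewrite -[v]hsubmxK; set x := lsubmx v; set y := rsubmx v.
rewrite /root_mx mul_row_block tr_row_mx mul_row_col !mul_mx_scalar !mxE.
rewrite -big_split/= => le0.
have ge0 (k : 'I_m) : 0 <= b * (x 0 k + y 0 k) ^+ 2 + (a - b) * (x 0 k ^+ 2 + y 0 k ^+ 2).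
  by rewrite addr_ge0// mulr_ge0 ?(ltW rootB_gt0) ?(ltW rootAB_gt0) ?addr_ge0 ?sqr_ge0.
have : \sum_k (b * (x 0 k + y 0 k) ^+ 2 + (a - b) * (x 0 k ^+ 2 + y 0 k ^+ 2)) == 0.
  rewrite eq_le sumr_ge0// andbT (le_trans _ le0)// le_eqVlt; apply/orP; left; apply/eqP.
  by apply: eq_bigr => k _; rewrite !mxE; ring.
rewrite psumr_eq0// => /allP xy0.
have xyk k : x 0 k = 0 /\ y 0 k = 0.
  have /eqP := xy0 k (mem_index_enum k).
  have := rootB_gt0; have := rootAB_gt0; have := sqr_ge0 (x 0 k + y 0 k).
  have := sqr_ge0 (x 0 k); have := sqr_ge0 (y 0 k) => y2 x2 s2 ab0 b0 e0.
  have : x 0 k ^+ 2 + y 0 k ^+ 2 <= 0.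
    by rewrite -(pmulr_rle0 _ ab0) -[leRHS]e0 lerDr mulr_ge0// ltW.
  by move=> le; split; apply/eqP; rewrite -sqrf_eq0 eq_le ?sqr_ge0 ?andbT; lra.
have -> : x = 0 by apply/rowP => k; rewrite [RHS]mxE; have [] := xyk k.
have -> : y = 0 by apply/rowP => k; rewrite [RHS]mxE; have [] := xyk k.
exact: row_mx0.
Qed.

Lemma root_mx_sqr : root_mx *m root_mx = Sigma_mx m r.
Proof.
rewrite /root_mx /Sigma_mx mulmx_block -!scalar_mxM -!raddfD/=.
rewrite -!expr2 root_norm [b ^+ 2 + _]addrC root_norm.
by congr block_mx; congr (_%:M); rewrite -root_corr; ring.
Qed.

(** Uniqueness of the positive semidefinite square root.  root_mx is a polynomial
in S ^ 2, so it commutes with S and (S - root_mx) (S + root_mx) = 0; the second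
factor has no kernel because root_mx is positive definite. *)
Lemma sqrt_Sigma_mx (S : 'M[R]_(m + m)) :
  (forall v : 'rV[R]_(m + m), 0 <= (v *m S *m v^T) 0 0) ->
  S *m S = Sigma_mx m r -> S = root_mx.
Proof.
move=> psd SS; have r0 : r != 0 by rewrite gt_eqF//; case/andP: r01.
have rootE : root_mx = (a - b / r)%:M + (b / r) *: Sigma_mx m r.
  rewrite /root_mx /Sigma_mx scale_block_mx !scale_scalar_mx divfK//.
  by rewrite mulr1 scalar_mx_block add_block_mx !add0r -raddfD/= subrK.
have comm : S *m root_mx = root_mx *m S.
  by rewrite rootE mulmxDl mulmxDr scalar_mxC -scalemxAl -scalemxAr -SS mulmxA.
have prod0 : (S - root_mx) *m (S + root_mx) = 0.
  by rewrite mulmxBl !mulmxDr comm SS root_mx_sqr [X in _ - X]addrC subrr.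
apply/eqP; rewrite -subr_eq0; apply/eqP/row_matrixP => i; rewrite row0.
apply: root_mx_posdef; set v := row i _.
have : (v *m (S + root_mx) *m v^T) 0 0 = 0.
  by rewrite -row_mul prod0 row0 mul0mx mxE.
by rewrite mulmxDr mulmxDl mxE => vv; have := psd v; lra.
Qed.

End square_root.

(** * The model as a family of independent normals *)

Section sigma_of_facts.
Context d (T : measurableType d) (R : realType).

Lemma sigma_ofS (I : finType) m (X : I -> T -> 'rV[R]_m) (i : I) :
  sigma_of (fun _ : unit => X i) `<=` sigma_of X.
Proof.
apply: sub_sigma_algebra2 => A [[[] k] _]; case=> B mB <-.
by exists (i, k) => //; exists B.
Qed.

Lemma sigma_of_bigcap (I J : finType) m (X : I -> T -> 'rV[R]_m) (A : J -> set T) :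
  (forall j, sigma_of X (A j)) -> sigma_of X [set w | forall j, A j w].
Proof.
move=> sA; rewrite (_ : mkset _ = \bigcap_(j in [set` [pred j : J | true]]) A j); last first.
  by apply/seteqP; split=> w h j //; exact: h.
by apply: (@fin_bigcap_measurable _ (g_sigma_algebraType _)) => // j _; exact: sA.
Qed.

Lemma sigma_of_coord (I : finType) m (X : I -> T -> 'rV[R]_m) (i : I) (k : 'I_m) :
  measurable_fun [set: g_sigma_algebraType (\bigcup_(c in [set: I * 'I_m])
        preimage_set_system setT (fun w => X c.1 w 0 c.2) measurable)]
     (fun w => X i w 0 k).
Proof.
move=> _ B mB; apply: sub_sigma_algebra; exists (i, k) => //.
by exists B.
Qed.

End sigma_of_facts.

Section gaussian_pair.
Context d (T : measurableType d) (R : realType) (P : probability T R).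

Lemma standard_normal_box m (Z : T -> 'rV[R]_m) (B : 'I_m -> set R) :
  standard_normal_vector P Z -> (forall i, measurable (B i)) ->
  P [set w | forall i, B i (Z w 0 i)] = (\prod_i gauss R (B i))%E.
Proof.
move=> [mZ lawZ indZ] mB.
have := indZ [set: 'I_m]%SET (fun i => [set w | B i (Z w 0 i)]).
rewrite (_ : \bigcap_(i in _) _ = [set w | forall i, B i (Z w 0 i)]); last first.
  by apply/seteqP; split=> w h i => [|_]; [apply: (h i); rewrite /= inE|exact: h].
move=> -> => [|i _]; last by exists (B i) => //; rewrite setTI.
by apply: eq_big => [i|i _]; [rewrite inE|exact: lawZ].
Qed.

(** The position in a vector of size m + m of the c-th normal of the k-th pair. *)
Definition pair_index m (kc : 'I_m * bool) : 'I_(m + m) :=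
  if kc.2 then rshift m kc.1 else lshift m kc.1.

(** A vector of law N(0, Sigma_mx m r) consists of m independent pairs as above.
The normals Z are recovered from X by inverting the square root, so boxes in Z
are events of the sigma-algebra of X. *)
Lemma centered_gaussian_pair m (X : T -> 'rV[R]_(m + m)) (r : R) :
  0 < r < 1 -> centered_gaussian P X (Sigma_mx m r) ->
  exists Z : 'I_m * bool -> T -> R,
  [/\ forall kc, measurable_fun setT (Z kc),
      forall k w, X w 0 (lshift m k) = rootA r * Z (k, false) w + rootB r * Z (k, true) w /\
                  X w 0 (rshift m k) = rootB r * Z (k, false) w + rootA r * Z (k, true) w,
      forall B : 'I_m * bool -> set R, (forall kc, measurable (B kc)) ->
        P [set w | forall kc, B kc (Z kc w)] = (\prod_kc gauss R (B kc))%E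
    & forall B : 'I_m * bool -> set R, (forall kc, measurable (B kc)) ->
        sigma_of (fun _ : unit => X) [set w | forall kc, B kc (Z kc w)]].
Proof.
move=> r01 [S [Z0 [ST psd SS nZ XE]]].
have SE := sqrt_Sigma_mx r01 psd SS.
set a := rootA r; set b := rootB r.
have ab0 : a ^+ 2 - b ^+ 2 != 0.
  rewrite subr_sqr mulf_neq0// gt_eqF//; first exact: rootAB_gt0.
  by have := rootAB_gt0 r01; have := rootB_gt0 r01; rewrite -/a -/b; lra.
pose Z (kc : 'I_m * bool) (w : T) : R := Z0 w 0 (pair_index kc).
have XZ k w : X w 0 (lshift m k) = a * Z (k, false) w + b * Z (k, true) w /\
              X w 0 (rshift m k) = b * Z (k, false) w + a * Z (k, true) w.
  rewrite XE SE /root_mx -[Z0 w]hsubmxK mul_row_block row_mxEl row_mxEr !mul_mx_scalar.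
  by rewrite /Z /pair_index/= !mxE; split.
exists Z; split=> //.
- by move=> kc; case: nZ => mZ _ _; exact: mZ.
- move=> B mB; pose B' i :=
    match fintype.split i with inl k => B (k, false) | inr k => B (k, true) end.
  have B'l k : B' (lshift m k) = B (k, false).
    by rewrite /B' -[lshift m k]/(unsplit (inl k)) unsplitK.
  have B'r k : B' (rshift m k) = B (k, true).
    by rewrite /B' -[rshift m k]/(unsplit (inr k)) unsplitK.
  transitivity (\prod_i gauss R (B' i))%E; last first.
    rewrite big_split_ord/= (eq_bigr (fun kc => gauss R (B (kc.1, kc.2)))); last by case.
    rewrite -(pair_bigA _ (fun k c => gauss R (B (k, c))))/= -big_split/=.
    by apply: eq_bigr => k _; rewrite big_bool/= muleC B'l B'r.
  rewrite -(standard_normal_box nZ); last by move=> i; rewrite /B'; case: (fintype.split i).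
  congr (P _); apply/seteqP; split=> w h.
    move=> i; rewrite /B' -[in Z0 w 0 i](fintype.splitK i); case: (fintype.split i) => k.
      exact: (h (k, false)).
    exact: (h (k, true)).
  move=> [k []]; rewrite /Z /pair_index/=.
    by rewrite -B'r; exact: h.
  by rewrite -B'l; exact: h.
- move=> B mB; apply: sigma_of_bigcap => -[k c].
  pose ST' := g_sigma_algebraType (\bigcup_(c in [set: unit * 'I_(m + m)])
        preimage_set_system setT (fun w => X w 0 c.2) measurable).
  have mX i : measurable_fun [set: ST'] (fun w => X w 0 i).
    exact: (@sigma_of_coord _ _ _ unit _ (fun=> X) tt i).
  suff mZ : measurable_fun [set: ST'] (Z (k, c)).
    by have := mZ measurableT _ (mB (k, c)); rewrite setTI.
  case: c.
  + rewrite (_ : Z _ = fun w => (a ^+ 2 - b ^+ 2)^-1 *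
      (a * X w 0 (rshift m k) - b * X w 0 (lshift m k))); last first.
      apply/funext => w; have [-> ->] := XZ k w.
      rewrite (_ : a * _ - _ = (a ^+ 2 - b ^+ 2) * Z (k, true) w) ?mulKf//; ring.
    apply: measurable_funM => //; apply: measurable_funB; exact: measurable_funM.
  + rewrite (_ : Z _ = fun w => (a ^+ 2 - b ^+ 2)^-1 *
      (a * X w 0 (lshift m k) - b * X w 0 (rshift m k))); last first.
      apply/funext => w; have [-> ->] := XZ k w.
      rewrite (_ : a * _ - _ = (a ^+ 2 - b ^+ 2) * Z (k, false) w) ?mulKf//; ring.
    apply: measurable_funM => //; apply: measurable_funB; exact: measurable_funM.
Qed.

End gaussian_pair.

(** The action of a permutation of the vertices on the coordinates of a featured
graph, that is edges and pairs (vertex, feature coordinate). *)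
Definition relabel n d (pi : 'S_n) (c : edge n + 'I_n * 'I_d) :
    edge n + 'I_n * 'I_d :=
  match c with
  | inl e => inl (edge_map pi e)
  | inr (v, k) => inr (pi v, k)
  end.

Section model.
Context disp (T : measurableType disp) (R : realType) (P : probability T R).
Variables (n d : nat) (rho r : R) (pi : 'S_n) (G1 G2 : T -> fgraph R n d).

(** The correlation between the two graphs at a coordinate. *)
Definition corr (c : edge n + 'I_n * 'I_d) : R := if c is inl _ then rho else r.

Lemma independent_boxes (I K : finType) m (X : I -> T -> 'rV[R]_m)
    (Z : I -> K -> T -> R) (B : I -> K -> set R) :
  independent_family P X ->
  (forall i k, measurable (B i k)) ->
  (forall i, P [set w | forall k, B i k (Z i k w)] = (\prod_k gauss R (B i k))%E) ->
  (forall i, sigma_of (fun _ : unit => X i) [set w | forall k, B i k (Z i k w)]) ->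
  P [set w | forall i k, B i k (Z i k w)] = (\prod_i \prod_k gauss R (B i k))%E.
Proof.
move=> indX mB PZ sZ.
have := indX [set: I]%SET (fun i => [set w | forall k, B i k (Z i k w)]) (fun i _ => sZ i).
rewrite (_ : \bigcap_(i in _) _ = [set w | forall i k, B i k (Z i k w)]); last first.
  by apply/seteqP; split=> w h i => [|_]; [apply: (h i); rewrite /= inE|exact: h].
by move=> ->; apply: eq_big => [i|i _]; rewrite ?inE.
Qed.

(** All the coordinates of the two graphs together, edges and features, are given
by a single family of independent standard normals. *)
Lemma featured_gaussian_wigner_iid : 0 < rho < 1 -> 0 < r < 1 ->
  featured_gaussian_wigner P rho r pi G1 G2 ->
  exists Z : (edge n + 'I_n * 'I_d) * bool -> T -> R,
  [/\ iid_gauss P Z,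
      forall i w, fgraph_coord (G1 w) i =
        pairX Z (fun i => rootA (corr i)) (fun i => rootB (corr i)) i w
    & forall i w, fgraph_coord (G2 w) (relabel pi i) =
        pairY Z (fun i => rootA (corr i)) (fun i => rootB (corr i)) i w].
Proof.
move=> rho01 r01 [gE indE gV indV indEV].
have /choice[ZE ZEP] := fun e => centered_gaussian_pair rho01 (gE e).
have /choice[ZV ZVP] := fun u => centered_gaussian_pair r01 (gV u).
pose Z (jc : (edge n + 'I_n * 'I_d) * bool) : T -> R :=
  match jc.1 with
  | inl e => ZE e (ord0, jc.2)
  | inr (u, k) => ZV u (k, jc.2)
  end.
exists Z; split.
- split.
    by move=> [[e|[u k]] c]; [case: (ZEP e)|case: (ZVP u)] => mZ _ _ _; exact: mZ.
  move=> B mB.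
  pose BE e (kc : 'I_1 * bool) := B (inl e, kc.2).
  pose BV u (kc : 'I_d * bool) := B (inr (u, kc.1), kc.2).
  pose EE := [set w | forall e kc, BE e kc (ZE e kc w)].
  pose EV := [set w | forall u kc, BV u kc (ZV u kc w)].
  have -> : [set w | forall j, B j (Z j w)] = EE `&` EV.
    apply/seteqP; split=> w.
      move=> h; split=> [e [k c]|u [k c]].
        by rewrite (ord1 k); exact: (h (inl e, c)).
      exact: (h (inr (u, k), c)).
    move=> [hE hV] [[e|[u k]] c]; first exact: (hE e (ord0, c)).
    exact: (hV u (k, c)).
  have PE e : P [set w | forall kc, BE e kc (ZE e kc w)] = (\prod_kc gauss R (BE e kc))%E.
    by case: (ZEP e) => _ _ PZ _; apply: PZ => kc; exact: mB.
  have PV u : P [set w | forall kc, BV u kc (ZV u kc w)] = (\prod_kc gauss R (BV u kc))%E.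
    by case: (ZVP u) => _ _ PZ _; apply: PZ => kc; exact: mB.
  have sE e : sigma_of (fun _ : unit => edge_pair G1 G2 pi e)
      [set w | forall kc, BE e kc (ZE e kc w)].
    by case: (ZEP e) => _ _ _; apply=> kc; exact: mB.
  have sV u : sigma_of (fun _ : unit => feature_pair G1 G2 pi u)
      [set w | forall kc, BV u kc (ZV u kc w)].
    by case: (ZVP u) => _ _ _; apply=> kc; exact: mB.
  rewrite indEV; first last.
  + by apply: sigma_of_bigcap => u; exact: sigma_ofS (sV u).
  + by apply: sigma_of_bigcap => e; exact: sigma_ofS (sE e).
  rewrite (independent_boxes indE) ?(independent_boxes indV)//; try by move=> *; exact: mB.
  rewrite [RHS](eq_bigr (fun jc => gauss R (B (jc.1, jc.2)))); last by case.
  rewrite -[RHS](pair_bigA _ (fun j c => gauss R (B (j, c))))/= big_sumType/=.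
  congr (_ * _)%E.
    apply: eq_bigr => e _; rewrite -(pair_bigA _ (fun k c => gauss R (B (inl e, c))))/=.
    by rewrite big_ord1.
  rewrite [RHS](eq_bigr (fun uk => \prod_c gauss R (B (inr (uk.1, uk.2), c)))%E); last by case.
  rewrite -[RHS](pair_bigA _ (fun u k => \prod_c gauss R (B (inr (u, k), c)))%E)/=.
  apply: eq_bigr => u _.
  by rewrite -(pair_bigA _ (fun k c => gauss R (B (inr (u, k), c))))/=.
- move=> [e|[u k]] w; rewrite /pairX /Z/=.
    have [_ /(_ ord0 w)[XE _] _ _] := ZEP e.
    by rewrite -XE /edge_pair row_mxEl mxE eqxx mulr1n.
  have [_ /(_ k w)[XE _] _ _] := ZVP u.
  by rewrite -XE /feature_pair row_mxEl.
- move=> [e|[u k]] w; rewrite /pairY /Z/=.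
    have [_ /(_ ord0 w)[_ XE] _ _] := ZEP e.
    by rewrite -XE /edge_pair row_mxEr mxE eqxx mulr1n.
  have [_ /(_ k w)[_ XE] _ _] := ZVP u.
  by rewrite -XE /feature_pair row_mxEr.
Qed.

End model.

(** * Scores and moved indices *)

Section score_coordinates.
Variables (R : realType) (n d : nat) (lambda : R).

(** The weight of a coordinate in the score. *)
Definition score_weight (c : edge n + 'I_n * 'I_d) : R :=
  if c is inl _ then lambda else 1 - lambda.

Lemma edge_mapM (s t : 'S_n) (e : edge n) :
  edge_map (s * t) e = edge_map t (edge_map s e).
Proof.
apply: val_inj => /=; rewrite -imset_comp; apply: eq_imset => x.
by rewrite permM.
Qed.

Lemma relabelM (s t : 'S_n) (c : edge n + 'I_n * 'I_d) :
  relabel (s * t) c = relabel t (relabel s c).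
Proof. by case: c => [e|[u k]] /=; rewrite (edge_mapM, permM). Qed.

Lemma relabel1 (c : edge n + 'I_n * 'I_d) : relabel 1 c = c.
Proof.
case: c => [e|[u k]] /=; rewrite ?perm1//; congr inl; apply: val_inj => /=.
by rewrite (eq_imset (g := id)) ?imset_id// => x; rewrite perm1.
Qed.

Lemma relabel_inj (s : 'S_n) : injective (@relabel n d s).
Proof. by apply: (can_inj (g := relabel s^-1)) => c; rewrite -relabelM mulgV relabel1. Qed.

Lemma scoreE (G1 G2 : fgraph R n d) (pi : 'S_n) :
  score lambda G1 G2 pi = \sum_(c : edge n + 'I_n * 'I_d)
    score_weight c * fgraph_coord G1 c * fgraph_coord G2 (relabel pi c).
Proof.
rewrite big_sumType/= /score; congr (_ + _).
  by rewrite mulr_sumr; apply: eq_bigr => e _; rewrite mulrA.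
rewrite mulr_sumr [RHS](eq_bigr (fun uk : 'I_n * 'I_d => (1 - lambda) *
    feature G1 uk.1 0 uk.2 * feature G2 (pi uk.1) 0 uk.2)); last by case.
rewrite -(pair_bigA _ (fun u k => (1 - lambda) *
    feature G1 u 0 k * feature G2 (pi u) 0 k))/=.
apply: eq_bigr => u _; rewrite mxE mulr_sumr; apply: eq_bigr => k _.
by rewrite !mxE mulrA.
Qed.

Lemma score_diff (G1 G2 : fgraph R n d) (s pi : 'S_n) :
  score lambda G1 G2 (s * pi) - score lambda G1 G2 pi =
  \sum_(c : edge n + 'I_n * 'I_d) score_weight c * fgraph_coord G1 c *
     (fgraph_coord G2 (relabel pi (relabel s c)) - fgraph_coord G2 (relabel pi c)).
Proof.
rewrite !scoreE -sumrB; apply: eq_bigr => c _.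
by rewrite mulrBr relabelM.
Qed.

End score_coordinates.

Section moved.
Local Open Scope set_scope.
Variable n : nat.
Implicit Type s : 'S_n.

(** The number of vertices moved by s. *)
Definition moved s : nat := #|[set v | s v != v]|.

(** An edge with an endpoint u moved by s is moved as soon as its other endpoint
is not s u; an edge is counted at most twice, once for each endpoint. *)
Lemma moved_edges s :
  (moved s * (n - 2) <= 2 * #|[set e : edge n | edge_map s e != e]|)%N.
Proof.
set E := [set e | _].
have -> : (2 * #|E| = \sum_(u : 'I_n) #|[set e in E | u \in val e]|)%N.
  rewrite mulnC -sum_nat_const.
  under [RHS]eq_bigr do rewrite -sum1_card.
  rewrite (exchange_big_dep (fun e => e \in E))/=; last first.
    by move=> u e _ /setIdP[].
  apply: eq_bigr => e eE; transitivity #|val e|; first by rewrite (eqP (valP e)).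
  by rewrite -sum1_card; apply: eq_bigl => u; rewrite inE eE.
rewrite /moved -sum_nat_const big_mkcond/=; apply: leq_sum => u _.
rewrite inE; case: ifP => // su.
pose A := ~: [set u; s u].
have cA : #|A| = (n - 2)%N.
  by rewrite cardsCs finset.setCK card_ord cards2 eq_sym su.
have inj : {in A &, injective (fun v => [set u; v])}.
  move=> v w; rewrite !inE !negb_or => /andP[vu _] /andP[wu _] vw.
  have : v \in [set u; w] by rewrite -vw !inE eqxx orbT.
  by rewrite !inE (negbTE vu) => /eqP.
rewrite -cA -(card_in_imset inj) -[leqRHS](card_imset _ val_inj).
apply: subset_leq_card; apply/fintype.subsetP => _ /imsetP[v + ->].
rewrite !inE negb_or => /andP[vu vsu].
have cuv : #|[set u; v]| == 2%N by rewrite cards2 (eq_sym u) vu.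
apply/imsetP; exists (exist _ [set u; v] cuv : edge n) => //.
rewrite !inE eqxx/= andbT; apply/eqP => /(congr1 val)/= fix_uv.
have : s u \in [set u; v] by rewrite -fix_uv imset_f// !inE eqxx.
by rewrite !inE (negbTE su) eq_sym (negbTE vsu).
Qed.

Lemma moved_features d s :
  #|[set c : 'I_n * 'I_d | (s c.1, c.2) != c]| = (moved s * d)%N.
Proof.
rewrite /moved -[d in RHS]card_ord -cardsT -cardsX; congr #|pred_of_set _|.
by apply/setP => -[u k]; rewrite !inE/= xpair_eqE eqxx !andbT.
Qed.

(** Enlarging the sum from permutations to all maps makes it a product over the
points. *)
Lemma sum_moved_le (R : realFieldType) (x : R) : 0 <= x ->
  \sum_(s : 'S_n) x ^+ moved s <= (1 + n.-1%:R * x) ^+ n.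
Proof.
move=> x0.
pose g (f : {ffun 'I_n -> 'I_n}) : R := \prod_i (if f i == i then 1 else x).
have g0 f : 0 <= g f by apply: prodr_ge0 => i _; case: ifP.
have -> : (1 + n.-1%:R * x) ^+ n = \sum_f g f.
  rewrite -(bigA_distr_bigA (fun i j => if j == i then 1 else x))/=.
  rewrite -[n in LHS]card_ord -prodr_const; apply: eq_bigr => i _.
  rewrite (bigD1 i)//= eqxx; congr (_ + _).
  rewrite (eq_bigr (fun=> x)); last by move=> j /negbTE ->.
  by rewrite sumr_const cardC1 card_ord mulr_natl.
rewrite (eq_bigr (fun s : 'S_n => g (pval s))); last first.
  move=> s _; rewrite /g /moved -prodr_const big_mkcond/=.
  by apply: eq_bigr => i _; rewrite inE -pvalE; case: eqP.
rewrite (bigID (mem [set pval s | s : 'S_n]))/= big_imset/=; last first.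
  by move=> s t _ _; exact: val_inj.
by rewrite (eq_bigl xpredT)// lerDl sumr_ge0.
Qed.

End moved.

(** * The estimator *)

(* A measurable type must be pointed; the chosen point is the zero graph. *)
HB.instance Definition _ (R : realType) (n d : nat) := gen_eqMixin (fgraph R n d).
HB.instance Definition _ (R : realType) (n d : nat) := gen_choiceMixin (fgraph R n d).
HB.instance Definition _ (R : realType) (n d : nat) :=
  isPointed.Build (fgraph R n d) (FGraph (fun=> 0) (fun=> 0)).

Section observation.
Variables (R : realType) (n d : nat).

(** The events that generate the observable ones. *)
Definition observation_gen : set (set (fgraph R n d * fgraph R n d)) :=
  \bigcup_(c in [set: edge n + 'I_n * 'I_d])
        (preimage_set_system setT (fun G => fgraph_coord G.1 c) measurable `|`
         preimage_set_system setT (fun G => fgraph_coord G.2 c) measurable).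

(** The type of pairs of featured graphs, with the observable events as measurable
sets. *)
Definition observation : measurableType _ := g_sigma_algebraType observation_gen.

Lemma measurable_coord1 c :
  measurable_fun [set: observation] (fun G => fgraph_coord G.1 c).
Proof.
by move=> _ B mB; apply: sub_sigma_algebra; exists c => //; left; exists B.
Qed.

Lemma measurable_coord2 c :
  measurable_fun [set: observation] (fun G => fgraph_coord G.2 c).
Proof.
by move=> _ B mB; apply: sub_sigma_algebra; exists c => //; right; exists B.
Qed.

Lemma measurable_score (lambda : R) (pi : 'S_n) :
  measurable_fun [set: observation] (fun G => score lambda G.1 G.2 pi).
Proof.
rewrite (_ : (fun G : observation => _) = fun G : observation =>
    \sum_(c <- enum [set: edge n + 'I_n * 'I_d]%SET) score_weight lambda c *
      fgraph_coord G.1 c * fgraph_coord G.2 (relabel pi c)); last first.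
  by apply/funext => G; rewrite scoreE big_enum/=; apply: eq_bigl => c; rewrite inE.
apply: measurable_sum => c; apply: measurable_funM; last exact: measurable_coord2.
by apply: measurable_funM => //; exact: measurable_coord1.
Qed.

Lemma measurable_observed disp (T : measurableType disp)
    (G1 G2 : T -> fgraph R n d) :
  (forall c, measurable_fun setT (fun w => fgraph_coord (G1 w) c)) ->
  (forall c, measurable_fun setT (fun w => fgraph_coord (G2 w) c)) ->
  forall A, observable A -> measurable [set w | A (G1 w, G2 w)].
Proof.
move=> mG1 mG2 A obsA.
have : measurable_fun setT (fun w => (G1 w, G2 w) : observation).
  apply: (@measurability _ _ T observation setT _ observation_gen) =>
    // _ [B [c _ [|]] [D mD <-] <-].
    by have := mG1 c measurableT _ mD; rewrite !setTI.
  by have := mG2 c measurableT _ mD; rewrite !setTI.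
by move=> /(_ measurableT A obsA); rewrite setTI.
Qed.

End observation.

(** A maximiser of the score, read off the finite table of comparisons. *)
Definition best_of n (le : {ffun 'S_n * 'S_n -> bool}) : 'S_n :=
  odflt 1%g [pick pi | [forall sigma, le (sigma, pi)]].

(** The table of comparisons between the scores of any two permutations. *)
Definition comparisons (R : realType) n d (lambda : R) (G1 G2 : fgraph R n d) :
    {ffun 'S_n * 'S_n -> bool} :=
  [ffun p => score lambda G1 G2 p.1 <= score lambda G1 G2 p.2].

(** The estimator depends on the data only through the finite table of comparisons
between scores, which makes its measurability immediate. *)
Definition argmax_estimator (R : realType) : estimator R :=
  fun n d lambda G1 G2 => best_of (comparisons lambda G1 G2).

Lemma argmax_estimatorP (R : realType) n d (lambda : R) (G1 G2 : fgraph R n d) :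
  is_argmax lambda G1 G2 (argmax_estimator lambda G1 G2).
Proof.
move=> sigma; rewrite /argmax_estimator /best_of; case: pickP => [pi|none].
  by move=> /forallP/(_ sigma); rewrite ffunE.
case: (Order.TotalTheory.arg_maxP (i0 := 1%g : 'S_n) (P := xpredT)
  (score lambda G1 G2) isT) => pi _ max_pi.
by have /forallP[] := none pi => s; rewrite ffunE; exact: max_pi.
Qed.

Lemma argmax_estimator_measurable (R : realType) :
  measurable_estimator (argmax_estimator (R := R)).
Proof.
move=> n d lambda pi.
pose O := @observation R n d.
suff : measurable ([set G | argmax_estimator lambda G.1 G.2 = pi] : set O) by [].
rewrite (_ : mkset _ = \bigcup_(m in [set` [pred m | @best_of n m == pi]])
   \bigcap_(p in [set` [pred p : 'S_n * 'S_n | true]])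
     [set G : O | (score lambda G.1 G.2 p.1 <= score lambda G.1 G.2 p.2) = m p]); last first.
  apply/seteqP; split=> [G <-|G [m + mG]].
    exists (comparisons lambda G.1 G.2); first by rewrite /= inE.
    by move=> p _ /=; rewrite ffunE.
  rewrite /= inE => /eqP <-; congr best_of; apply/ffunP => p; rewrite ffunE; exact: mG.
apply: fin_bigcup_measurable => // m _; apply: fin_bigcap_measurable => // p _.
have mle : measurable_fun [set: O]
    (fun G : O => score lambda G.1 G.2 p.1 <= score lambda G.1 G.2 p.2).
  by apply: measurable_fun_ler; exact: measurable_score.
by have := mle measurableT [set m p] I; rewrite setTI.
Qed.

(** * The error probability for fixed n *)

Section error_probability.
Context disp (T : measurableType disp) (R : realType) (P : probability T R).
Variables (n d : nat) (rho r lambda : R) (pi : 'S_n) (G1 G2 : T -> fgraph R n d).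
Hypotheses (rho01 : 0 < rho < 1) (r01 : 0 < r < 1) (lambda01 : 0 < lambda < 1).
Hypothesis model : featured_gaussian_wigner P rho r pi G1 G2.

Lemma corr01 (c : edge n + 'I_n * 'I_d) : 0 < corr rho r c < 1.
Proof. by case: c. Qed.

Lemma measurable_coords :
  (forall c, measurable_fun setT (fun w => fgraph_coord (G1 w) c)) /\
  (forall c, measurable_fun setT (fun w => fgraph_coord (G2 w) c)).
Proof.
have [Z [iidZ XE YE]] := featured_gaussian_wigner_iid rho01 r01 model.
split=> c.
  by rewrite (funext (XE c)); exact: (measurable_pairX iidZ).
rewrite (_ : c = relabel pi (relabel pi^-1 c)); last first.
  by rewrite -relabelM mulVg relabel1.
by rewrite (funext (YE _)); exact: (measurable_pairY iidZ).
Qed.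

Lemma score_diff_mgf (t : R) (s : 'S_n) :
  0 <= t -> 3 * t * lambda <= rho / 2 -> 3 * t * (1 - lambda) <= r / 2 ->
  (\int[P]_w (expR (t * (score lambda (G1 w) (G2 w) (s * pi) -
                         score lambda (G1 w) (G2 w) pi)))%:E <=
   (expR (- (#|[set e : edge n | edge_map s e != e]%SET|%:R * ln (1 + 3 * t * lambda * rho)
     + (moved s * d)%:R * ln (1 + 3 * t * (1 - lambda) * r)) / 6))%:E)%E.
Proof.
move=> t0 tE tV; case/andP: lambda01 => l0 l1.
have [Z [iidZ XE YE]] := featured_gaussian_wigner_iid rho01 r01 model.
pose sc c : R := 3 * t * @score_weight R n d lambda c.
pose a c := rootA (@corr R n d rho r c); pose b c := rootB (@corr R n d rho r c).
have corrE c : 2 * a c * b c = corr rho r c by rewrite root_corr// corr01.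
have := @permuted_correlation_mgf _ _ _ P _ Z iidZ a b (fun c => root_norm (corr01 c))
  (relabel s) sc (@relabel_inj n d s).
rewrite (eq_integral (fun w => (expR (t * (score lambda (G1 w) (G2 w) (s * pi) -
                         score lambda (G1 w) (G2 w) pi)))%:E)); last first.
  move=> w _; congr (expR _)%:E; rewrite score_diff mulr_sumr; apply: eq_bigr => c _.
  by rewrite XE !YE /sc -/a -/b; field.
rewrite big_sumType/=.
rewrite (eq_bigl (mem [set e : edge n | edge_map s e != e]%SET)); last first.
  by move=> e; rewrite [RHS]inE; congr negb; apply/eqP/eqP => [[]|->].
rewrite (eq_bigr (fun=> ln (1 + 3 * t * lambda * rho))); last first.
  by move=> e _; rewrite corrE.
rewrite [X in (_ + X)](eq_bigl (mem [set c : 'I_n * 'I_d | (s c.1, c.2) != c]%SET)); last first.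
  by move=> [u k]; rewrite [RHS]inE; congr negb; apply/eqP/eqP => [[-> //]|[->]].
rewrite [X in (_ + X)](eq_bigr (fun=> ln (1 + 3 * t * (1 - lambda) * r))); last first.
  by move=> c _; rewrite corrE.
rewrite !sumr_const moved_features -[_ *+ #|_|]mulr_natl -[_ *+ (_ * d)]mulr_natl.
apply=> c.
have l1': 0 <= 1 - lambda by rewrite subr_ge0 ltW.
by rewrite corrE /sc; case: c => [e|c] /=; rewrite ?tE ?tV andbT !mulr_ge0 // ltW.
Qed.

Hypothesis n4 : (4 <= n)%N.
(* The target exponent is 3 * moved s * ln n, after a division by 6: hence the
   factor 18.  For the edges there is a further factor 4, as at least
   moved s * n / 4 edges are moved when n >= 4. *)
Hypothesis strongE : 72 * ln n%:R <= n%:R * ln (1 + rho ^+ 2 / 2).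
Hypothesis strongV : 18 * ln n%:R <= d%:R * ln (1 + r ^+ 2 / 2).

(** The largest t that satisfies both constraints of score_diff_mgf makes one of
them an equality; the corresponding kind of indices, edges or features, already
gives the bound. *)
Lemma exists_exponent : exists2 t : R, 0 <= t & forall s : 'S_n,
  (\int[P]_w (expR (t * (score lambda (G1 w) (G2 w) (s * pi) -
                         score lambda (G1 w) (G2 w) pi)))%:E <=
   (n%:R ^- 3 ^+ moved s)%:E)%E.
Proof.
case/andP: rho01 => rho0 rho1; case/andP: r01 => r0 r1; case/andP: lambda01 => l0 l1.
have l1' : 0 < 1 - lambda by rewrite subr_gt0.
have n0 : 0 < n%:R :> R by rewrite ltr0n (leq_trans _ n4).
have lnn0 : 0 <= ln n%:R :> R by rewrite ln_ge0// ler1n (leq_trans _ n4).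
pose tE := rho / (6 * lambda); pose tV := r / (6 * (1 - lambda)).
have tEE : 3 * tE * lambda = rho / 2 by rewrite /tE; field; rewrite gt_eqF.
have tVE : 3 * tV * (1 - lambda) = r / 2 by rewrite /tV; field; rewrite gt_eqF.
have tE0 : 0 <= tE by rewrite divr_ge0 ?mulr_ge0 ?ltW.
have tV0 : 0 <= tV by rewrite divr_ge0 ?mulr_ge0 ?ltW.
have ln0 (x : R) : 0 <= x -> 0 <= ln (1 + x) by move=> x0; rewrite ln_ge0// lerDl.
pose t := Num.min tE tV.
have t0 : 0 <= t by rewrite le_min tE0.
have ttE : 3 * t * lambda <= rho / 2.
  by rewrite -tEE ler_pM2r// ler_pM2l// ge_min lexx.
have ttV : 3 * t * (1 - lambda) <= r / 2.
  by rewrite -tVE ler_pM2r// ler_pM2l// ge_min lexx orbT.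
exists t => // s; apply: (le_trans (score_diff_mgf s t0 ttE ttV)).
have -> : n%:R ^- 3 ^+ moved s = expR (- (18 * (moved s)%:R * ln n%:R) / 6) :> R.
  rewrite -{1}[n%:R](lnK (x := n%:R)) ?posrE// -!expRM_natl -expRN -expRM_natl.
  by congr expR; field.
rewrite lee_fin ler_expR ler_pM2r// lerN2.
set NE := #|_|%:R.
have NEge : (moved s)%:R * n%:R / 4 <= NE.
  have := moved_edges s; rewrite -(ler_nat R) !natrM natrB ?(leq_trans _ n4)// => h.
  have n4' : 4 <= n%:R :> R by rewrite (ler_nat R 4).
  have m0 : 0 <= (moved s)%:R :> R by [].
  by rewrite -/NE in h; nra.
have lE0 : 0 <= ln (1 + 3 * t * lambda * rho) by rewrite ln0// !mulr_ge0// ltW.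
have lV0 : 0 <= ln (1 + 3 * t * (1 - lambda) * r) by rewrite ln0// !mulr_ge0// ltW.
rewrite natrM; have [tEV|tVE'] := leP tE tV.
  apply: (@le_trans _ _ (NE * ln (1 + 3 * t * lambda * rho))); last first.
    by rewrite lerDl !mulr_ge0.
  rewrite /t (min_idPl tEV) tEE (_ : rho / 2 * rho = rho ^+ 2 / 2); last by field.
  apply: (@le_trans _ _ ((moved s)%:R * n%:R / 4 * ln (1 + rho ^+ 2 / 2))); last first.
    by rewrite ler_wpM2r// ln0// divr_ge0// sqr_ge0.
  have := ler_wpM2l (ler0n R (moved s)) strongE; lra.
apply: (@le_trans _ _ ((moved s)%:R * d%:R * ln (1 + 3 * t * (1 - lambda) * r))); last first.
  by rewrite lerDr mulr_ge0.
rewrite /t (min_idPr (ltW tVE')) tVE (_ : r / 2 * r = r ^+ 2 / 2); last by field.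
have := ler_wpM2l (ler0n R (moved s)) strongV; lra.
Qed.

Lemma error_probability_le :
  (P [set w | argmax_estimator lambda (G1 w) (G2 w) <> pi] <=
   ((1 + n.-1%:R * n%:R ^- 3) ^+ n - 1)%:E)%E.
Proof.
have [mG1 mG2] := measurable_coords; have [t t0 mgf] := exists_exponent.
pose D s w := score lambda (G1 w) (G2 w) (s * pi) - score lambda (G1 w) (G2 w) pi.
have mscore s : measurable_fun setT (fun w => score lambda (G1 w) (G2 w) s).
  rewrite (_ : (fun w => _) = fun w =>
      \sum_(c <- enum [set: edge n + 'I_n * 'I_d]%SET) score_weight lambda c *
      fgraph_coord (G1 w) c * fgraph_coord (G2 w) (relabel s c)); last first.
    by apply/funext => w; rewrite scoreE big_enum/=; apply: eq_bigl => c; rewrite inE.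
  apply: measurable_sum => c; apply: measurable_funM => //.
  exact: measurable_funM.
have mD s : measurable_fun setT (fun w => (expR (t * D s w))%:E).
  apply/measurable_EFinP; apply: measurableT_comp => //; apply: measurable_funM => //.
  exact: measurable_funB.
set E := [set w | _].
have mE : measurable E.
  rewrite (_ : E = ~` [set w | argmax_estimator lambda (G1 w) (G2 w) = pi]); last first.
    by apply/seteqP; split.
  apply: measurableC; apply: (measurable_observed mG1 mG2
    (A := [set G | argmax_estimator lambda G.1 G.2 = pi])).
  exact: argmax_estimator_measurable.
rewrite -[E]setIT -integral_indic//.
pose l := enum [pred s : 'S_n | s != 1%g].
(* On the event of an error, the term of the index s that relates the estimate
   to pi is at least exp 0. *)
apply: (@le_trans _ _ (\int[P]_w \sum_(s <- l) (expR (t * D s w))%:E)%E).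
  apply: ge0_le_integral => //.
  - by apply/measurable_EFinP; exact: measurable_indic.
  - by apply: emeasurable_sum.
  - move=> w _; rewrite /l sumEFin lee_fin indicE big_enum/=.
    have [|_] := boolP (w \in E); last by rewrite sumr_ge0// => s _; exact: expR_ge0.
    rewrite inE /E/=; set p := argmax_estimator lambda (G1 w) (G2 w) => Ew.
    have s1 : (p * pi^-1)%g != 1%g.
      by apply/eqP => h; apply: Ew; rewrite -(mulgVK pi p) h mul1g.
    rewrite (bigD1 (p * pi^-1)%g s1)/= ler_wpDr ?sumr_ge0//.
    rewrite -[leLHS]expR0 ler_expR mulr_ge0// /D mulgVK subr_ge0.
    exact: argmax_estimatorP.
rewrite ge0_integral_sum//.
apply: (@le_trans _ _ (\sum_(s <- l) (n%:R ^- 3 ^+ moved s)%:E)%E).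
  by apply: lee_sum => s _; exact: mgf.
rewrite sumEFin lee_fin lerBrDl /l big_enum/=.
have x0 : 0 <= n%:R ^- 3 :> R by rewrite invr_ge0 exprn_ge0.
apply: le_trans (sum_moved_le n x0); rewrite [leRHS](bigD1 1%g)//= lerD2r.
rewrite (_ : moved 1 = 0%N) ?expr0//.
by apply/eqP; rewrite cards_eq0; apply/eqP/finset.setP => v; rewrite !inE perm1 eqxx.
Qed.

End error_probability.

(** * Asymptotics *)

Section logarithms.
Variable R : realType.
Implicit Types x u : R.

Lemma ln1D_le u : 0 <= u -> ln (1 + u) <= u.
Proof.
move=> u0; rewrite -[leRHS](expRK u) ler_ln ?posrE ?expR_gt0 ?ltr_wpDr//.
exact: expR_ge1Dx.
Qed.

Lemma ln1D_ge u : 0 <= u -> u / (1 + u) <= ln (1 + u).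
Proof.
move=> u0; have u1 : 0 < 1 + u by rewrite ltr_wpDr.
rewrite -[leRHS]opprK -lnV ?posrE// lerNr -[leRHS](expRK) ler_ln ?posrE ?expR_gt0 ?invr_gt0//.
apply: le_trans (expR_ge1Dx _); rewrite le_eqVlt; apply/orP; left; apply/eqP.
by field; rewrite gt_eqF.
Qed.

(** The exponent obtained, in terms of the one of the theorem: they are comparable
unless x is close to 1, in which case the former is at least a constant. *)
Lemma ln_half_square_ge x : 0 < x < 1 ->
  ln (1 / (1 - x ^+ 2)) / 5 <= ln (1 + x ^+ 2 / 2) \/ 5^-1 <= ln (1 + x ^+ 2 / 2).
Proof.
case/andP=> x0 x1; set q := x ^+ 2.
have q0 : 0 <= q by exact: sqr_ge0.
have q1 : 0 < 1 - q by rewrite /q; nra.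
have h2 : 0 <= q / 2 by rewrite divr_ge0.
have h21 : 0 < 1 + q / 2 by rewrite ltr_wpDr.
have lower := ln1D_ge h2.
have [qs|qb] := leP q 2^-1.
  left; rewrite (_ : 1 / (1 - q) = 1 + q / (1 - q)); last by field; rewrite gt_eqF.
  have up : ln (1 + q / (1 - q)) <= 2 * q.
    apply: le_trans (ln1D_le _) _; first by rewrite divr_ge0// ltW.
    rewrite ler_pdivrMr//; nra.
  have : 2 / 5 * q <= q / 2 / (1 + q / 2) by rewrite ler_pdivlMr//; nra.
  lra.
by right; apply: le_trans lower; rewrite ler_pdivlMr//; lra.
Qed.

(** From ln n <= 2 sqrt n. *)
Lemma ln_le_near (c : R) : 0 <= c -> \forall n \near \oo, c * ln n%:R <= n%:R :> R.
Proof.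
move=> c0; near=> n.
have n1 : 1 <= n%:R :> R by near: n; exact: nbhs_infty_ger.
have n0 : 0 < n%:R :> R by exact: lt_le_trans n1.
have nc : (2 * c) ^+ 2 <= n%:R by near: n; exact: nbhs_infty_ger.
set s := Num.sqrt n%:R : R.
have s2 : s ^+ 2 = n%:R by rewrite sqr_sqrtr// ltW.
have sc : 2 * c <= s by rewrite -ler_sqr ?nnegrE ?sqrtr_ge0 ?mulr_ge0// s2.
have ls : ln n%:R <= 2 * s.
  have := expR_ge1Dx (ln n%:R / 2 : R); rewrite -sqrtr_expR_ln// -/s; lra.
have s0 : 0 <= s by exact: sqrtr_ge0.
rewrite -[leRHS]s2; apply: (@le_trans _ _ (c * (2 * s))); first by rewrite ler_wpM2l.
nra.
Unshelve. all: by end_near. Qed.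

End logarithms.

Section asymptotics.
Variable R : realType.

Lemma pow_le_expR_inv (n : nat) : (0 < n)%N ->
  (1 + n.-1%:R * n%:R ^- 3) ^+ n <= expR (n%:R^-1) :> R.
Proof.
move=> n0; have nR : 0 < n%:R :> R by rewrite ltr0n.
rewrite (_ : n%:R^-1 = n%:R * n%:R ^- 2); last by field; rewrite gt_eqF.
rewrite expRM_natl lerXn2r ?nnegrE ?expR_ge0 ?addr_ge0 ?mulr_ge0 ?invr_ge0 ?exprn_ge0//.
apply: le_trans (expR_ge1Dx _); rewrite lerD2l.
rewrite (_ : n%:R ^- 2 = n%:R * n%:R ^- 3); last by field; rewrite gt_eqF.
by rewrite ler_wpM2r ?invr_ge0 ?exprn_ge0// ler_nat leq_pred.
Qed.

Lemma cvg_expR_inv_nat : expR (n%:R^-1) - 1 @[n --> \oo] --> (0 : R).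
Proof.
rewrite -[X in _ --> X](subrr 1) -[X in _ --> X - _]expR0.
apply: cvgB; last exact: cvg_cst.
apply: continuous_cvg; first exact: continuous_expR.
rewrite -cvg_shiftS; exact: cvg_harmonic.
Qed.

End asymptotics.

(** The two correlations are strong enough separately as soon as they are so
jointly and comparable. *)
Lemma balanced_sum_ge (R : realType) (Gamma x y c : R) :
  0 < Gamma -> 0 <= y -> 1 / Gamma <= x / y <= Gamma ->
  (1 + Gamma) * c <= x + y -> c <= x /\ c <= y.
Proof.
move=> Gamma0 y0 /andP[lo hi] sum.
have {}y0 : 0 < y.
  rewrite lt_neqAle y0 andbT; apply/eqP => y0'.
  by move: lo; rewrite -y0' invr0 mulr0 leNgt divr_gt0.
rewrite ler_pdivrMr// in hi; rewrite ler_pdivlMr// mulrAC mul1r ler_pdivrMr// in lo.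
have G1 : 0 < 1 + Gamma by rewrite ltr_wpDr// ltW.
by split; rewrite -(ler_pM2l G1); apply: le_trans sum _; lra.
Qed.

Lemma ln_half_square_scale (R : realType) (x N c : R) : 0 < x < 1 -> 0 <= N ->
  5 * c <= N -> 5 * c <= N * ln (1 / (1 - x ^+ 2)) ->
  c <= N * ln (1 + x ^+ 2 / 2).
Proof.
move=> x01 N0 hN hNL.
by have [] := ln_half_square_ge x01 => /(ler_wpM2l N0); lra.
Qed.

Lemma ln_inv_ge0 (R : realType) (x : R) : 0 < x < 1 -> 0 <= ln (1 / (1 - x ^+ 2)).
Proof.
case/andP=> x0 x1; have q1 : 0 < 1 - x ^+ 2 by nra.
by rewrite ln_ge0// ler_pdivlMr// mul1r gerBl sqr_ge0.
Qed.

Theorem proposition6 (R : realType) (Gamma delta : R)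
    (hGamma : 0 < Gamma) (hdelta : 0 < delta < 2^-1) :
  exists C0 : R, exists pihat : estimator R,
    [/\ measurable_estimator pihat,
        forall (n d : nat) (lambda : R) (G1 G2 : fgraph R n d),
          is_argmax lambda G1 G2 (pihat n d lambda G1 G2)
      & forall (d : nat -> nat) (rho r : nat -> R)
          (pistar : forall n : nat, 'S_n)
          (disp : nat -> measure_display)
          (T : forall n : nat, measurableType (disp n))
          (P : forall n : nat, probability (T n) R)
          (G1 G2 : forall n : nat, T n -> fgraph R n (d n)),
        (forall n, 0 < rho n < 1) ->
        (forall n, 0 < r n < 1) ->
        (forall n, featured_gaussian_wigner (P n) (rho n) (r n) (pistar n)
                     (G1 n) (G2 n)) ->
        (\forall n \near \oo,
           1 / Gamma
             <= (n%:R * ln (1 / (1 - rho n ^+ 2)))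
                / ((d n)%:R * ln (1 / (1 - r n ^+ 2)))
             <= Gamma) ->
        ((d n)%:R / ln n%:R : R) @[n --> \oo] --> +oo ->
        (\forall n \near \oo,
           C0 * ln n%:R <= n%:R * ln (1 / (1 - rho n ^+ 2))
                           + (d n)%:R * ln (1 / (1 - r n ^+ 2))) ->
        forall lambda : R, delta < lambda < 1 - delta ->
          P n [set w | pihat n (d n) lambda (G1 n w) (G2 n w) <> pistar n]
            @[n --> \oo] --> 0%E].
Proof.
(* The value 72 is the one asked for by error_probability_le, and the factor 5
   comes from ln_half_square_ge. *)
have [c cE] : exists c : R, c = 72 by exists 72.
have c0 : 0 <= 5 * c by rewrite cE mulr_ge0.
exists ((1 + Gamma) * (5 * c)), (@argmax_estimator R); split.
- exact: argmax_estimator_measurable.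
- by move=> n d lambda G1 G2; exact: argmax_estimatorP.
move=> d rho r pistar disp T P G1 G2 rho01 r01 model ratio dlarge signal lambda lam.
have lambda01 : 0 < lambda < 1.
  by case/andP: hdelta => d0 d1; case/andP: lam => l0 l1; apply/andP; split; lra.
apply: (@squeeze_cvge _ _ _ _ (fun=> 0%E) _ (fun n => (expR (n%:R^-1) - 1)%:E)); last 2 first.
- exact: cvg_cst.
- by apply: cvg_EFin; [exact: nearW | exact: cvg_expR_inv_nat].
have nlarge := ln_le_near c0.
have {}dlarge : \forall n \near \oo, 5 * c <= (d n)%:R / ln n%:R.
  by move/cvgryPge : dlarge; apply.
near=> n.
have n4 : (4 <= n)%N by near: n; exact: nbhs_infty_ge.
have lnn : 0 < ln n%:R :> R by rewrite ln_gt0// ltr1n (leq_trans _ n4).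
have nn : 5 * c * ln n%:R <= n%:R by near: n; exact: nlarge.
have dn : 5 * c * ln n%:R <= (d n)%:R.
  by rewrite -ler_pdivlMr//; near: n; exact: dlarge.
have [x y] : 5 * c * ln n%:R <= n%:R * ln (1 / (1 - rho n ^+ 2)) /\
             5 * c * ln n%:R <= (d n)%:R * ln (1 / (1 - r n ^+ 2)).
  apply: (balanced_sum_ge hGamma).
  - by rewrite mulr_ge0// ln_inv_ge0.
  - by near: n; exact: ratio.
  - by rewrite mulrA; near: n; exact: signal.
have strongE : c * ln n%:R <= n%:R * ln (1 + rho n ^+ 2 / 2).
  by apply: ln_half_square_scale (rho01 n) _ _ _ => //; rewrite mulrA.
have strongV : c * ln n%:R <= (d n)%:R * ln (1 + r n ^+ 2 / 2).
  by apply: ln_half_square_scale (r01 n) _ _ _ => //; rewrite mulrA.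
rewrite measure_ge0/=.
rewrite cE in strongE strongV.
apply: le_trans (error_probability_le (rho01 n) (r01 n) lambda01 (model n) n4 strongE _) _.
  by apply: le_trans strongV; rewrite ler_wpM2r ?ltW// ltr_nat.
by rewrite lee_fin lerD2r pow_le_expR_inv// (leq_trans _ n4).
Unshelve. all: by end_near. Qed.
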